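(* Let $B_1,\dots,B_D$ be resonator blocks, let $\chi\in\{1,\dots,D\}^{\mathbb{Z}}$ be a pseudo-ergodic block sequence, and let $\mathcal{J}(\chi)$ be the associated Jacobi operator on $\ell^2(\mathbb{Z})$. Let $\lambda\ge0$. (i) If $|\mathrm{tr}\,\mathcal{P}^\lambda_d|>2$ for all $d=1,\dots,D$ and the family $\{\mathcal{P}^\lambda_1,\dots,\mathcal{P}^\lambda_D\}$ satisfies the source-sink condition, then $\lambda\notin\sigma(\mathcal{J}(\chi))$. (ii) If $|\mathrm{tr}\,\mathcal{P}^\lambda_d|\le2$ for some $d\in\{1,\dots,D\}$, then $\lambda\in\sigma(\mathcal{J}(\chi))$.
   Context: A resonator block $B_d$ is a finite sequence of $\mathrm{len}(B_d)\ge1$ triples $(v_k(B_d),\ell_k(B_d),s_k(B_d))$ of positive reals (wave speed, length, spacing). The resonator sequence $(v_i,\ell_i,s_i)_{i\in\mathbb{Z}}$ of $\chi$ is obtained by concatenating $B_{\chi(j)}$, $j\in\mathbb{Z}$, in order, with the first resonator of $B_{\chi(0)}$ at index $0$. The Jacobi operator is $(\mathcal{J}(\chi)\mathbf{v})^{(i)}=a^{(i-1)}\mathbf{v}^{(i-1)}+a^{(i)}\mathbf{v}^{(i+1)}+b^{(i)}\mathbf{v}^{(i)}$ with $a^{(i)}=-\frac{v_iv_{i+1}}{s_i\sqrt{\ell_i\ell_{i+1}}}$, $b^{(i)}=\frac{v_i^2}{\ell_i}\big(\frac1{s_{i-1}}+\frac1{s_i}\big)$. $\chi$ is pseudo-ergodic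 if every finite word in $\{1,\dots,D\}^M$, $M\in\mathbb{N}$, occurs as a consecutive subword of $\chi$. For $\ell,s,v>0$ let $P^\lambda_{\ell,s,v}=\begin{pmatrix}1-s\frac{\ell}{v^2}\lambda & s\\ -\frac{\ell}{v^2}\lambda & 1\end{pmatrix}$; the block propagation matrix is $\mathcal{P}^\lambda_d=P^\lambda_{\ell_L,s_L,v_L}\cdots P^\lambda_{\ell_1,s_1,v_1}$ with $L=\mathrm{len}(B_d)$ and $(v_k,\ell_k,s_k)$ the parameters of $B_d$. For hyperbolic $A\in\mathrm{SL}(2,\mathbb{R})$ (i.e. $|\mathrm{tr}A|>2$) with eigenvalues $|\xi_1|<1<|\xi_2|$ and eigenlines $E_1,E_2$, its source is $s(A)=E_1$ and its sink $u(A)=E_2$, viewed as points of $\mathbb{RP}^1$. A family of hyperbolic $\{A_1,\dots,A_D\}$ satisfies the source-sink condition if all sinks $u(A_d)$ lie in the same connected component of $\mathbb{RP}^1\setminus\{s(A_1),\dots,s(A_D)\}$. *)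

(* Defs.v *)
From mathcomp Require Import all_boot all_order all_algebra.
From mathcomp Require Import all_classical all_reals all_analysis.
Set Implicit Arguments. Unset Strict Implicit. Unset Printing Implicit Defensive.
Import Order.TTheory GRing.Theory Num.Theory numFieldNormedType.Exports.
Local Open Scope ring_scope.
Local Open Scope classical_set_scope.

Section Resonators.
Variable R : realType.

(* A resonator is a triple (v, l, s) = (wave speed, length, spacing). *)
Definition resonator := (R * R * R)%type.
Definition rv (r : resonator) : R := r.1.1.
Definition rl (r : resonator) : R := r.1.2.
Definition rs (r : resonator) : R := r.2.
Definition dflt_res : resonator := (1, 1, 1).

Definition is_block (b : seq resonator) : Prop :=
  (0 < size b)%N /\ forall r, r \in b -> [/\ 0 < rv r, 0 < rl r & 0 < rs r].

Variable D : nat.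
Variable B : 'I_D -> seq resonator.
Variable chi : int -> 'I_D.

(* forward walk: the i-th resonator (i >= 0) starting at the first resonator
   of block chi j ; fuel argument (sufficient since blocks are nonempty). *)
Fixpoint res_fwd (fuel : nat) (j : int) (i : nat) : resonator :=
  match fuel with
  | O => dflt_res
  | S f => let b := B (chi j) in
           if (i < size b)%N then nth dflt_res b i
           else res_fwd f (j + 1) (i - size b)
  end.

Fixpoint res_bwd (fuel : nat) (j : int) (m : nat) : resonator :=
  match fuel with
  | O => dflt_res
  | S f => let b := B (chi j) in
           if (m < size b)%N then nth dflt_res b (size b - 1 - m)
           else res_bwd f (j - 1) (m - size b)
  end.

(* The resonator sequence of chi: concatenation of the blocks B (chi j),
   with the first resonator of B (chi 0) at index 0. *)
Definition res_seq (i : int) : resonator :=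
  if 0 <= i then res_fwd (absz i).+1 0 (absz i)
  else res_bwd (absz (- i - 1)).+1 (-1) (absz (- i - 1)).

Definition vv i := rv (res_seq i).
Definition ll i := rl (res_seq i).
Definition ss i := rs (res_seq i).

Definition jac_a (i : int) : R :=
  - (vv i * vv (i + 1)) / (ss i * Num.sqrt (ll i * ll (i + 1))).
Definition jac_b (i : int) : R :=
  vv i ^+ 2 / ll i * ((ss (i - 1))^-1 + (ss i)^-1).

Definition jacobi (u : int -> R) (i : int) : R :=
  jac_a (i - 1) * u (i - 1) + jac_a i * u (i + 1) + jac_b i * u i.

End Resonators.

Section L2.
Variable R : realType.

Definition sq_terms (u : int -> R) : nat -> R :=
  fun n => u (n%:Z) ^+ 2 + u (- (n.+1)%:Z) ^+ 2.
Definition in_l2 (u : int -> R) : Prop := cvgn (series (sq_terms u)).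
Definition l2_norm (u : int -> R) : R := Num.sqrt (limn (series (sq_terms u))).

Definition in_resolvent (T : (int -> R) -> (int -> R)) (lam : R) : Prop :=
  (forall f, in_l2 f ->
     exists u, [/\ in_l2 u, (forall i, T u i - lam * u i = f i) &
       forall w, in_l2 w -> (forall i, T w i - lam * w i = f i) -> w = u])
  /\ exists C : R, forall u f, in_l2 u -> in_l2 f ->
       (forall i, T u i - lam * u i = f i) -> l2_norm u <= C * l2_norm f.

Definition in_spectrum (T : (int -> R) -> (int -> R)) (lam : R) : Prop :=
  ~ in_resolvent T lam.
End L2.

Section Propag.
Variable R : realType.

Definition mx2 (a b c d : R) : 'M[R]_2 :=
  \matrix_(i < 2, j < 2)
    (if i == 0 then (if j == 0 then a else b) else (if j == 0 then c else d)).

Definition Pmat (lam : R) (r : resonator R) : 'M[R]_2 :=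
  mx2 (1 - rs r * rl r / rv r ^+ 2 * lam) (rs r)
      (- (rl r / rv r ^+ 2 * lam)) 1.

Definition block_prop (lam : R) (b : seq (resonator R)) : 'M[R]_2 :=
  foldl (fun M r => Pmat lam r *m M) 1%:M b.

Definition hyperbolic (A : 'M[R]_2) : Prop := 2 < `|\tr A|.

(* RP^1 is identified with the unit circle S^1 in R^2 via the standard
   homeomorphism: the line spanned by (x,y) |-> ((x^2-y^2), 2xy)/(x^2+y^2). *)
Definition circle : set (R * R) := [set p | p.1 ^+ 2 + p.2 ^+ 2 = 1].
Definition line_pt (x : 'cV[R]_2) : R * R :=
  let a := x 0 0 in let c := x 1 0 in
  ((a ^+ 2 - c ^+ 2) / (a ^+ 2 + c ^+ 2), 2 * a * c / (a ^+ 2 + c ^+ 2)).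

Definition eigenline_pt (A : 'M[R]_2) (P : R -> Prop) (p : R * R) : Prop :=
  exists (x : 'cV[R]_2) (xi : R), [/\ x != 0, A *m x = xi *: x, P xi &
                                      p = line_pt x].

Definition source_pt (A : 'M[R]_2) (p : R * R) : Prop :=
  eigenline_pt A (fun xi => `|xi| < 1) p.
Definition sink_pt (A : 'M[R]_2) (p : R * R) : Prop :=
  eigenline_pt A (fun xi => 1 < `|xi|) p.

Definition source_sink {D : nat} (A : 'I_D -> 'M[R]_2) : Prop :=
  let S := [set p | exists d, source_pt (A d) p] in
  forall d d' p p', sink_pt (A d) p -> sink_pt (A d') p' ->
    connected_component (circle `\` S) p p'.
End Propag.

Definition pseudo_ergodic {D : nat} (chi : int -> 'I_D) : Prop :=
  forall w : seq 'I_D, exists j : int,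
    forall k : nat, (k < size w)%N -> chi (j + k%:Z) = nth (chi j) w k.

(* Main.v *)
Require Import Defs.
From mathcomp Require Import all_boot all_order all_algebra.
From mathcomp Require Import all_classical all_reals all_analysis.
From mathcomp Require Import ring lra zify.
Import Order.TTheory GRing.Theory Num.Theory numFieldNormedType.Exports.
Local Open Scope ring_scope.
Set Implicit Arguments. Unset Strict Implicit. Unset Printing Implicit Defensive.

(** With [phi_i = v_i u_i / sqrt l_i] and
    [psi_i = (phi_i - phi_(i-1)) / s_(i-1)], the equation [J u - lam u = f]
    becomes the first-order system [x_(i+1) = P_i x_i + h_i] for
    [x_i = (phi_i, psi_i)].

    (i) The source-sink condition provides a quadratic form [Q] that is negative
    on all sources and positive on all sinks. In an eigenbasis of a block matrix
    [A], whose eigenvalues multiply to 1, the cross term of [Q] is invariant, so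
    that [Q(A x) - Q(x)] is positive definite. Summing this increment over a
    window bounds [x] by [h] in [l2]. For existence one solves the system on
    windows [[-N, N]] with [Q >= 0] at the left end and [Q <= 0] at the right
    end; the same inequality, applied to the difference of two such solutions,
    shows that they converge.

    (ii) If [|tr A| <= 2], some orbit of [A] is bounded above and away from 0.
    The block of [A] is repeated arbitrarily often in [chi]; the corresponding
    solution, cut off to such a stretch, has [l2] norm growing with the length
    of the stretch, while [(J - lam) u] stays bounded, being supported at the
    four cut-off points. *)

(** * Linear maps and quadratic forms on the plane *)

Section Plane.
Variable R : realType.
Implicit Types (x y h : R * R) (M N : 'M[R]_2) (t : R).

Definition nsq x : R := x.1 ^+ 2 + x.2 ^+ 2.
Definition scl t x : R * R := (t * x.1, t * x.2).
Definition wedge x y : R := x.1 * y.2 - x.2 * y.1.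
Definition app M x : R * R :=
  (M 0 0 * x.1 + M 0 1 * x.2, M 1 0 * x.1 + M 1 1 * x.2).
Definition qf M x : R :=
  M 0 0 * x.1 ^+ 2 + (M 0 1 + M 1 0) * (x.1 * x.2) + M 1 1 * x.2 ^+ 2.

Lemma nsq_ge0 x : 0 <= nsq x.
Proof. by rewrite addr_ge0 // sqr_ge0. Qed.

Lemma nsq_eq0 x : (nsq x == 0) = (x == 0).
Proof. by case: x => a b; rewrite paddr_eq0 ?sqr_ge0 // !sqrf_eq0. Qed.

Lemma nsq_gt0 x : x != 0 -> 0 < nsq x.
Proof. by move=> x0; rewrite lt_neqAle eq_sym nsq_eq0 x0 nsq_ge0. Qed.

Lemma nsqB_le x y : nsq (x - y) <= 2 * nsq x + 2 * nsq y.
Proof.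
case: x y => a b [c d]; rewrite /nsq /=.
have := sqr_ge0 (a + c); have := sqr_ge0 (b + d); lra.
Qed.

Lemma nsq_scl t x : nsq (scl t x) = t ^+ 2 * nsq x.
Proof. by rewrite /nsq /scl /=; ring. Qed.

Lemma mulmx2E M N i j : (M *m N) i j = M i 0 * N 0 j + M i 1 * N 1 j.
Proof.
rewrite mxE big_ord_recl big_ord1; congr (_ + _ * _); congr (_ _ _);
  exact: val_inj.
Qed.

Lemma det_mx2 M : \det M = M 0 0 * M 1 1 - M 0 1 * M 1 0.
Proof.
rewrite (expand_det_row _ 0) big_ord_recl big_ord1 /cofactor !det_mx11 !mxE /=.
have -> : lift 0 0 = 1 :> 'I_2 by apply: val_inj.
have -> : lift 1 0 = 0 :> 'I_2 by apply: val_inj.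
by rewrite expr0 expr1 mul1r mulN1r mulrN.
Qed.

Lemma tr_mx2 M : \tr M = M 0 0 + M 1 1.
Proof.
rewrite /mxtrace big_ord_recl big_ord1; congr (_ + _).
by congr (M _ _); apply: val_inj.
Qed.

Lemma appM M N x : app (M *m N) x = app M (app N x).
Proof. by case: x => a b; rewrite /app !mulmx2E /=; congr pair; ring. Qed.

Lemma app1 x : app 1%:M x = x.
Proof. by case: x => a b; rewrite /app !mxE /=; congr pair; ring. Qed.

Lemma appD M x y : app M (x + y) = app M x + app M y.
Proof. by case: x y => a b [c d]; rewrite /app /=; congr pair => /=; ring. Qed.

Lemma appB M x y : app M (x - y) = app M x - app M y.
Proof. by case: x y => a b [c d]; rewrite /app /=; congr pair => /=; ring. Qed.

Lemma appZ M t x : app M (scl t x) = scl t (app M x).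
Proof. by case: x => a b; rewrite /app /scl /=; congr pair => /=; ring. Qed.

Lemma wedge_app M x y : wedge (app M x) (app M y) = \det M * wedge x y.
Proof. by rewrite det_mx2 /wedge /app /=; ring. Qed.

Lemma wedge_eq0 x y : x != 0 -> wedge x y = 0 -> exists t, y = scl t x.
Proof.
case: x y => a b [c d] x0; have := nsq_gt0 x0; rewrite /nsq /wedge /= => n0 w0.
exists ((a * c + b * d) / (a ^+ 2 + b ^+ 2)); rewrite /scl /=.
have nz : a ^+ 2 + b ^+ 2 != 0 by rewrite gt_eqF.
have bcad : b * c = a * d by lra.
congr pair; apply: (mulIf nz); rewrite mulrAC divfK //.
  have : b * (b * c) = b * (a * d) by rewrite bcad.
  lra.
have : a * (b * c) = a * (a * d) by rewrite bcad.
lra.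
Qed.

Lemma qf_scl M t x : qf M (scl t x) = t ^+ 2 * qf M x.
Proof. by rewrite /qf /scl /=; ring. Qed.

Lemma qf_pull M N t x :
  qf (N^T *m M *m N - t%:M) x = qf M (app N x) - t * nsq x.
Proof.
have E i j : (N^T *m M *m N - t%:M) i j
    = (N^T *m M *m N) i j - t *+ (i == j).
  by move: (N^T *m M *m N) => A; rewrite !mxE.
by rewrite /qf !E !mulmx2E ![N^T _ _]mxE /app /nsq /=; ring.
Qed.

Definition mxbnd (K : R) M := forall i j, `|M i j| <= K.

Lemma mxbndP K M : mxbnd K M <->
  [/\ `|M 0 0| <= K, `|M 0 1| <= K, `|M 1 0| <= K & `|M 1 1| <= K].
Proof.
split=> [H|[H1 H2 H3 H4] i j]; first by split.
have I2 (k : 'I_2) : k = 0 \/ k = 1.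
  by case: k => [[|[|//]]] p; [left|right]; apply: val_inj.
by case: (I2 i) => ->; case: (I2 j) => ->.
Qed.

Lemma qf_bound K M x : mxbnd K M -> `|qf M x| <= 2 * K * nsq x.
Proof.
move=> /mxbndP[]; case: x => a b; rewrite !ler_norml /qf /nsq /=.
move: (M 0 0) (M 0 1) (M 1 0) (M 1 1) => p q r s /andP[? ?] /andP[? ?] /andP[? ?] /andP[? ?].
have := sqr_ge0 a; have := sqr_ge0 b; have := sqr_ge0 (a - b); have := sqr_ge0 (a + b).
rewrite sqrrB sqrrD -mulr_natl.
move: (a ^+ 2) (b ^+ 2) => A C; set D := a * b => ? ? ? ?.
apply/andP; split; nra.
Qed.

Lemma app_bound K M x : mxbnd K M -> nsq (app M x) <= 4 * K ^+ 2 * nsq x.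
Proof.
move=> /mxbndP[]; case: x => a b; rewrite /nsq /app /=.
move: (M 0 0) (M 0 1) (M 1 0) (M 1 1) => p q r s Hp Hq Hr Hs.
have sq (z : R) : `|z| <= K -> z ^+ 2 <= K ^+ 2.
  by move=> zK; rewrite -(real_normK (num_real z)) ler_sqr ?nnegrE // (le_trans _ zK).
have cs (z w : R) : `|z| <= K -> `|w| <= K -> (z * a + w * b) ^+ 2 <= 2 * K ^+ 2 * (a ^+ 2 + b ^+ 2).
  move=> /sq Hz /sq Hw.
  have := sqr_ge0 (z * b - w * a); have := sqr_ge0 a; have := sqr_ge0 b.
  nra.
have := cs _ _ Hp Hq; have := cs _ _ Hr Hs; lra.
Qed.

(* AM-GM on the cross term of [qf M (x + h)]. *)
Lemma qf_perturb K M e x h : mxbnd K M -> 0 < e ->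
  qf M x - e * nsq x - (2 * K + 4 * K ^+ 2 / e) * nsq h <= qf M (x + h).
Proof.
move=> bM e0.
have K0 : 0 <= K by apply: le_trans (bM 0 0).
have := qf_bound h bM; rewrite ler_norml => /andP[lo _].
(* [c] is the gradient of the form at [x], so the cross term is the inner product of [c] and [h]. *)
set c := (2 * M 0 0 * x.1 + (M 0 1 + M 1 0) * x.2,
          (M 0 1 + M 1 0) * x.1 + 2 * M 1 1 * x.2) : R * R.
have Dq : qf M (x + h) = qf M x + (c.1 * h.1 + c.2 * h.2) + qf M h.
  by rewrite /qf /c /=; ring.
have cb : nsq c <= 16 * K ^+ 2 * nsq x.
  have := @app_bound (2 * K) (mx2 (2 * M 0 0) (M 0 1 + M 1 0) (M 0 1 + M 1 0) (2 * M 1 1)) x.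
  rewrite /app !mxE /= -/c => H; apply: le_trans (H _) _; last by lra.
  have n2 (z : R) : `|z| <= K -> `|2 * z| <= 2 * K.
    by move=> ?; rewrite normrM ger0_norm // ler_pM2l.
  have nD (z w : R) : `|z| <= K -> `|w| <= K -> `|z + w| <= 2 * K.
    by move=> ? ?; apply: le_trans (ler_normD _ _) _; lra.
  by apply/mxbndP; rewrite !mxE /=; split; rewrite ?n2 ?nD.
have young : - (e * nsq x) - 4 * K ^+ 2 / e * nsq h <= c.1 * h.1 + c.2 * h.2.
  (* The completed square below divides by [K ^+ 2], so [K = 0] is settled first. *)
  have [K00|Kn] := eqVneq K 0.
    have c00 : nsq c = 0 by apply/eqP; rewrite eq_le nsq_ge0 andbT; move: cb; rewrite K00; lra.
    have /eqP c0 : c == 0 by rewrite -nsq_eq0 c00.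
    rewrite c0 /= K00 expr0n /=.
    have := nsq_ge0 x; nra.
  have Kp : 0 < K ^+ 2 by rewrite exprn_gt0 // lt_neqAle eq_sym Kn.
  set k := K ^+ 2 in cb Kp *.
  have := sqr_ge0 (c.1 / (4 * k) * e + 2 * h.1); have := sqr_ge0 (c.2 / (4 * k) * e + 2 * h.2).
  move=> s2 s1.
  have {s1 s2} : 0 <= e ^+ 2 * nsq c / (16 * k ^+ 2) + e * (c.1 * h.1 + c.2 * h.2) / k + 4 * nsq h.
    apply: le_trans (addr_ge0 s1 s2) _; rewrite le_eqVlt; apply/orP; left; apply/eqP.
    by rewrite /nsq; field; rewrite gt_eqF.
  have cb' : e ^+ 2 * nsq c / (16 * k ^+ 2) <= e ^+ 2 * nsq x / k.
    rewrite ler_pdivrMr; last by rewrite mulr_gt0 // exprn_gt0.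
    have -> : e ^+ 2 * nsq x / k * (16 * k ^+ 2) = e ^+ 2 * (16 * k * nsq x) by field; rewrite gt_eqF.
    by rewrite ler_wpM2l // sqr_ge0.
  move=> s.
  have {cb'}s : 0 <= e ^+ 2 * nsq x / k + e * (c.1 * h.1 + c.2 * h.2) / k + 4 * nsq h by lra.
  rewrite -subr_ge0 -(pmulr_rge0 _ e0).
  rewrite -(pmulr_rge0 _ Kp) in s.
  apply: le_trans s _; rewrite le_eqVlt; apply/orP; left; apply/eqP.
  by field; rewrite !gt_eqF.
rewrite Dq; lra.
Qed.

End Plane.

(** * Systems with an increasing quadratic form *)

Lemma exists_nat_gt (R : realType) (x : R) : exists n : nat, x < n%:R.
Proof.
exists (Num.Def.archi_bound `|x|).
exact: le_lt_trans (ler_norm x) (archi_boundP (normr_ge0 x)).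
Qed.

(** * Sums over symmetric windows *)

Section WindowSums.
Variable R : realType.
Implicit Types (F G : int -> R) (N m n : nat).

(* The sum of [F] over the window [-N, N), enumerated as in [sq_terms]. *)
Definition wsum F N : R := \sum_(0 <= n < N) (F n%:Z + F (- n.+1%:Z)).

Lemma wsum0 F : wsum F 0 = 0.
Proof. by rewrite /wsum big_geq. Qed.

Lemma wsumS F N : wsum F N.+1 = wsum F N + (F N%:Z + F (- N.+1%:Z)).
Proof. by rewrite /wsum big_nat_recr. Qed.

Lemma wsumD F G N : wsum (fun i => F i + G i) N = wsum F N + wsum G N.
Proof. by elim: N => [|N IH]; rewrite ?wsum0 ?addr0 // !wsumS IH; ring. Qed.

Lemma wsumZ c F N : wsum (fun i => c * F i) N = c * wsum F N.
Proof. by elim: N => [|N IH]; rewrite ?wsum0 ?mulr0 // !wsumS IH; ring. Qed.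

Lemma ler_wsum F G N : (forall i : int, - N%:Z <= i < N%:Z -> F i <= G i) ->
  wsum F N <= wsum G N.
Proof.
elim: N => [|N IH] H; first by rewrite !wsum0.
rewrite !wsumS lerD // ?IH // => [i Hi|]; first by apply: H; lia.
by rewrite lerD // H //; lia.
Qed.

Lemma wsum_ge0 F N : (forall i, 0 <= F i) -> 0 <= wsum F N.
Proof. by move=> F0; apply: sumr_ge0 => n _; rewrite addr_ge0. Qed.

Lemma wsum_mono F m N : (forall i, 0 <= F i) -> (m <= N)%N ->
  wsum F m <= wsum F N.
Proof.
move=> F0; elim: N => [|N IH]; first by rewrite leqn0 => /eqP ->.
rewrite leq_eqVlt => /orP[/eqP -> //|]; rewrite ltnS => /IH /le_trans; apply.
by rewrite wsumS lerDl addr_ge0.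
Qed.

Lemma wsum_telescope F N :
  wsum (fun i => F (i + 1) - F i) N = F N%:Z - F (- N%:Z).
Proof.
elim: N => [|N IH]; first by rewrite wsum0 oppr0 subrr.
rewrite wsumS IH.
have -> : - N.+1%:Z + 1 = - N%:Z by lia.
have -> : N%:Z + 1 = N.+1%:Z by lia.
ring.
Qed.

Lemma wsum_shiftr F N : (forall i, 0 <= F i) ->
  wsum (fun i => F (i + 1)) N <= wsum F N.+1.
Proof.
move=> F0; have := wsum_telescope F N.
have -> : wsum (fun i => F (i + 1) - F i) N
          = wsum (fun i => F (i + 1)) N + -1 * wsum F N.
  by rewrite -wsumZ -wsumD; apply: eq_bigr => n _; ring.
rewrite wsumS.
have := F0 (- N%:Z); have := F0 (- N.+1%:Z); lra.
Qed.

Lemma wsum_shiftl F N : (forall i, 0 <= F i) ->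
  wsum (fun i => F (i - 1)) N <= wsum F N.+1.
Proof.
move=> F0; have := wsum_telescope (fun i => F (i - 1)) N.
have -> : wsum (fun i => F (i + 1 - 1) - F (i - 1)) N
          = wsum F N + -1 * wsum (fun i => F (i - 1)) N.
  by rewrite -wsumZ -wsumD; apply: eq_bigr => n _; rewrite !addrK; ring.
rewrite wsumS.
have -> : - N%:Z - 1 = - N.+1%:Z by lia.
have := F0 N%:Z; have := F0 (N%:Z - 1); lra.
Qed.

Lemma le_wsum F N (i : int) : (forall i, 0 <= F i) -> - N%:Z <= i < N%:Z ->
  F i <= wsum F N.
Proof.
move=> F0; elim: N => [|N IH] Hi; first by lia.
rewrite wsumS.
have [->|iN] := eqVneq i N%:Z.
  have := F0 (- N.+1%:Z); have := wsum_ge0 N F0; lra.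
have [->|iN'] := eqVneq i (- N.+1%:Z).
  have := F0 N%:Z; have := wsum_ge0 N F0; lra.
have /IH : - N%:Z <= i < N%:Z by lia.
have := F0 (- N.+1%:Z); have := F0 N%:Z; lra.
Qed.

(** Enlarging window [n] adds the indices [n] and [-n-1], not [n] and [-n]. Summing [F] together
    with its shift catches both ends; this causes the factor 2 and the window [N.+1]. *)
Lemma wsum_ends F c m N : (forall i, 0 <= F i) -> (m <= N)%N ->
  (forall n, (m <= n < N)%N -> c <= F n%:Z + F (- n%:Z)) ->
  c * (N - m)%:R <= 2 * wsum F N.+1.
Proof.
move=> F0 mN H.
pose F' i := F i + F (i + 1).
have F'0 i : 0 <= F' i by rewrite addr_ge0.
apply: (@le_trans _ _ (wsum F' N)); last first.
  rewrite wsumD mulr2n mulrDl !mul1r lerD ?wsum_shiftr //.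
  exact: wsum_mono.
elim: N mN H => [|N IH] mN H.
  by rewrite sub0n mulr0 wsum0.
move: mN; rewrite leq_eqVlt => /orP[/eqP ->|]; first by rewrite subnn mulr0 wsum_ge0.
rewrite ltnS => mN.
have {}IH : c * (N - m)%:R <= wsum F' N.
  by apply: IH => // n /andP[mn nN]; apply: H; rewrite mn ltnS ltnW.
rewrite subSn // -natr1 mulrDr mulr1 wsumS lerD //.
have /H : (m <= N < N.+1)%N by rewrite mN leqnn.
rewrite /F'; have -> : - N.+1%:Z + 1 = - N%:Z by lia.
have := F0 (- N.+1%:Z); have := F0 (N%:Z + 1); lra.
Qed.

(** If all end pairs beyond [m] exceeded [d], the window sums would grow linearly by [wsum_ends].
    This supplies windows with negligible boundary terms. *)
Lemma small_ends F K d m : (forall i, 0 <= F i) -> (forall N, wsum F N <= K) ->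
  0 < d -> exists2 N, (m <= N)%N & F N%:Z + F (- N%:Z) <= d.
Proof.
move=> F0 FK d0; apply: contrapT => H.
have {}H n : (m <= n)%N -> d <= F n%:Z + F (- n%:Z).
  by move=> mn; rewrite leNgt; apply/negP => lt; apply: H; exists n => //; exact: ltW.
have K0 : 0 <= K by have := FK 0%N; rewrite wsum0.
have [k kK] := exists_nat_gt (2 * K / d).
have := @wsum_ends F d m (m + k) F0 (leq_addr _ _).
rewrite addKn => /(_ (fun n Hn => H n (proj1 (andP Hn)))).
have := FK (m + k).+1; move: kK; rewrite ltr_pdivrMr //; lra.
Qed.

End WindowSums.

Section Limits.
Variable R : realType.
Local Open Scope classical_set_scope.

Lemma cauchy_rate_cvg (a : nat -> R) :
  (forall e, 0 < e -> exists N, forall n, (N <= n)%N -> `|a n - a N| <= e) ->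
  cvgn a.
Proof.
move=> H; apply/cauchy_cvgP; apply: cauchy_exP => e e0.
have [N HN] := H (e / 2) (divr_gt0 e0 (ltr0n _ 2)).
exists (a N); exists N => // n /= Nn.
rewrite /ball /= distrC; apply: le_lt_trans (HN n Nn) _; lra.
Qed.

Lemma cvg_wsum (F : nat -> int -> R) (F' : int -> R) m :
  (forall i, F n i @[n --> \oo] --> F' i) ->
  wsum (F n) m @[n --> \oo] --> wsum F' m.
Proof.
move=> H; elim: m => [|m IH].
  by under eq_fun do rewrite wsum0; rewrite wsum0; exact: cvg_cst.
under eq_fun do rewrite wsumS; rewrite wsumS.
by apply: cvgD => //; apply: cvgD.
Qed.

End Limits.

(** * A priori bound and solvability for the forced system *)

Section Dichotomy.
Variable R : realType.
Variables (P G : int -> 'M[R]_2) (K eta : R).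
Hypothesis P_bnd : forall i, mxbnd K (P i).
Hypothesis G_bnd : forall i, mxbnd K (G i).
Hypothesis eta_gt0 : 0 < eta.
Hypothesis G_incr : forall i y,
  qf (G i) y + eta * nsq y <= qf (G (i + 1)) (app (P i) y).
Hypothesis G_pos : forall i, exists2 e : R * R, e != 0 & 0 <= qf (G i) e.
Hypothesis G_neg : forall i, exists2 e : R * R, e != 0 & qf (G i) e <= 0.
Implicit Types (x h z : int -> R * R) (N : nat).

Let K_ge0 : 0 <= K. Proof. exact: le_trans (P_bnd 0 0 0). Qed.

Definition solves_on N h x := forall i : int, - N%:Z <= i < N%:Z ->
  x (i + 1) = app (P i) (x i) + h i.

Lemma energy_step : exists2 C, 0 <= C & forall h x i,
  x (i + 1) = app (P i) (x i) + h i ->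
  eta / 2 * nsq (x i) <=
    qf (G (i + 1)) (x (i + 1)) - qf (G i) (x i) + C * nsq (h i).
Proof.
(* With this [e], the Young loss [e * nsq (app (P i) (x i))] consumes at most half of the gain
   [eta]; the [+ 1] covers [K = 0]. *)
pose e := eta / (2 * (4 * K ^+ 2 + 1)).
have K2 : 0 <= K ^+ 2 by rewrite sqr_ge0.
have D0 : 0 < 4 * K ^+ 2 + 1 by lra.
have e0 : 0 < e by rewrite divr_gt0 // mulr_gt0.
exists (2 * K + 4 * K ^+ 2 / e).
  by apply: addr_ge0; [apply: mulr_ge0|apply: divr_ge0; [apply: mulr_ge0|apply: ltW]].
move=> h x i Hi.
have pert := qf_perturb (app (P i) (x i)) (h i) (G_bnd (i + 1)) e0.
rewrite -Hi in pert.
have := G_incr i (x i).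
have : e * nsq (app (P i) (x i)) <= eta / 2 * nsq (x i).
  apply: le_trans (ler_wpM2l (ltW e0) (app_bound _ (P_bnd i))) _.
  rewrite mulrA ler_wpM2r ?nsq_ge0 //.
  have -> : e * (4 * K ^+ 2) = eta / 2 * (4 * K ^+ 2 / (4 * K ^+ 2 + 1)).
    by rewrite /e; field; rewrite gt_eqF.
  rewrite ler_piMr //; first by rewrite divr_ge0 ?ltW.
  by rewrite ler_pdivrMr //; lra.
lra.
Qed.

Lemma energy_window : exists2 C, 0 <= C & forall N h x, solves_on N h x ->
  eta / 2 * wsum (fun i => nsq (x i)) N <=
    qf (G N%:Z) (x N%:Z) - qf (G (- N%:Z)) (x (- N%:Z))
    + C * wsum (fun i => nsq (h i)) N.
Proof.
have [C C0 HC] := energy_step; exists C => // N h x Hx.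
rewrite -(wsum_telescope (fun i => qf (G i) (x i))) -!wsumZ -wsumD.
by apply: ler_wsum => i Hi; apply: HC; exact: Hx.
Qed.

(** Shooting: a forced solution [a] started at 0 plus a multiple of the homogeneous solution [k]
    started at a vector [e] with nonnegative form. After at least one step the form of [k] is
    positive, so at the right end [k] is not parallel to the nonpositive vector [f], and [t] can be
    chosen to make the sum a multiple of [f]. *)
Lemma truncated_solution N h : (0 < N)%N -> exists x,
  [/\ solves_on N h x, 0 <= qf (G (- N%:Z)) (x (- N%:Z))
    & qf (G N%:Z) (x N%:Z) <= 0].
Proof.
move=> N0.
have [e e0 qe] := G_pos (- N%:Z).
have [f f0 qf0] := G_neg N%:Z.
pose fix s (b : bool) (v : R * R) n : R * R :=
  if n is n'.+1 then
    app (P (- N%:Z + n'%:Z)) (s b v n') + (if b then h (- N%:Z + n'%:Z) else 0)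
  else v.
pose a := s true 0; pose k := s false e.
have kq n : qf (G (- N%:Z)) e + eta * (0 < n)%N%:R * nsq e
            <= qf (G (- N%:Z + n%:Z)) (k n).
  elim: n => [|n IH]; first by rewrite /= mulr0 mul0r !addr0.
  have -> : - N%:Z + n.+1%:Z = - N%:Z + n%:Z + 1 by lia.
  rewrite /k /= addr0 -/(k n); apply: le_trans (G_incr _ _).
  case: n IH => [|n] /= IH; first by rewrite addr0 mulr1.
  apply: le_trans IH _; rewrite lerDl mulr_ge0 ?nsq_ge0 //; exact: ltW.
have kN : 0 < qf (G N%:Z) (k (N + N)%N).
  have := kq (N + N)%N; rewrite addn_gt0 N0 /= mulr1.
  have -> : - N%:Z + (N + N)%:Z = N%:Z by lia.
  by apply: lt_le_trans; have := mulr_gt0 eta_gt0 (nsq_gt0 e0); lra.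
have w0 : wedge f (k (N + N)%N) != 0.
  apply: contraL kN => /eqP /(wedge_eq0 f0)[t ->].
  by rewrite qf_scl -leNgt mulr_ge0_le0 // sqr_ge0.
pose t := - wedge f (a (N + N)%N) / wedge f (k (N + N)%N).
exists (fun i => a (absz (i + N%:Z)) + scl t (k (absz (i + N%:Z)))); split.
- move=> i /andP[i1 i2].
  have -> : (absz (i + 1 + N%:Z)) = (absz (i + N%:Z)).+1 by lia.
  have Ei : - N%:Z + (absz (i + N%:Z)) = i by lia.
  rewrite /a /k /= Ei appD appZ addr0; move: (app _ _) (app _ _) (h i) => u v w.
  by rewrite addrAC.
- have -> : (absz (- N%:Z + N%:Z)) = 0%N by lia.
  by rewrite /a /k /= add0r qf_scl mulr_ge0 // sqr_ge0.
have -> : (absz (N%:Z + N%:Z)) = (N + N)%N by lia.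
have : wedge f (a (N + N)%N + scl t (k (N + N)%N)) = 0.
  have -> : wedge f (a (N + N)%N + scl t (k (N + N)%N))
     = wedge f (a (N + N)%N) + t * wedge f (k (N + N)%N).
    by rewrite /wedge /scl /=; ring.
  by rewrite divfK // subrr.
move=> /(wedge_eq0 f0)[c ->].
by rewrite qf_scl mulr_ge0_le0 // sqr_ge0.
Qed.

(** The bound [A] serves only to find windows with arbitrarily small end values through
    [small_ends]. On these the boundary terms of the energy inequality disappear up to [d], leaving
    a bound in terms of [B] alone. *)
Lemma apriori_bound : exists2 C, 0 <= C & forall h x A B,
  (forall i, x (i + 1) = app (P i) (x i) + h i) ->
  (forall N, wsum (fun i => nsq (x i)) N <= A) ->
  (forall N, wsum (fun i => nsq (h i)) N <= B) ->
  forall N, wsum (fun i => nsq (x i)) N <= C * B.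
Proof.
have [C C0 HC] := energy_window; exists (2 * C / eta).
  by rewrite divr_ge0 ?mulr_ge0 // ltW.
move=> h x A B Hx HA HB N.
apply/ler_addgt0Pr => d d0.
have K0 := K_ge0.
have K1 : 0 < 2 * K + 1 by lra.
have d'0 : 0 < d * eta / (2 * (2 * K + 1)) by rewrite divr_gt0 ?mulr_gt0.
have [M NM HM] := small_ends N (fun i => nsq_ge0 (x i)) HA d'0.
apply: le_trans (wsum_mono (fun i => nsq_ge0 (x i)) NM) _.
have en := HC M h x (fun i _ => Hx i).
have CB := ler_wpM2l C0 (HB M).
have := qf_bound (x M%:Z) (G_bnd M%:Z); rewrite ler_norml => /andP[_ q1].
have := qf_bound (x (- M%:Z)) (G_bnd (- M%:Z)); rewrite ler_norml => /andP[q2 _].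
have n1 := nsq_ge0 (x M%:Z); have n2 := nsq_ge0 (x (- M%:Z)).
move: HM; rewrite ler_pdivlMr ?mulr_gt0 // => HM.
rewrite -(ler_pM2l eta_gt0).
have -> : eta * (2 * C / eta * B + d) = 2 * (C * B) + d * eta.
  by field; rewrite gt_eqF.
nra.
Qed.

(** Without forcing, the energy inside each window [n] between [m] and [N] is controlled by the two
    end values at [n] and [-n]. Summing over these [n] bounds [N - m] copies of an inner value by
    the total mass [A]. *)
Lemma homogeneous_decay z A N m (i : int) : solves_on N.+1 (fun=> 0) z ->
  wsum (fun i => nsq (z i)) N.+1 <= A -> (m <= N)%N ->
  - m%:Z <= i < m%:Z -> eta * nsq (z i) * (N - m)%:R <= 4 * K * A.
Proof.
move=> Hz HA mN im.
have z0 j : 0 <= nsq (z j) by exact: nsq_ge0.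
have energy n : (n <= N)%N -> eta * wsum (fun i => nsq (z i)) n
    <= 2 * K * nsq (z n%:Z) + 2 * K * nsq (z (- n%:Z)).
  move=> nN; apply: (@le_trans _ _ (qf (G n%:Z) (z n%:Z)
                       - qf (G (- n%:Z)) (z (- n%:Z)))).
    rewrite -(wsum_telescope (fun i => qf (G i) (z i))) -wsumZ.
    apply: ler_wsum => j Hj; rewrite Hz ?addr0; last by lia.
    by have := G_incr j (z j); lra.
  have := qf_bound (z n%:Z) (G_bnd n%:Z); rewrite ler_norml => /andP[_].
  have := qf_bound (z (- n%:Z)) (G_bnd (- n%:Z)); rewrite ler_norml => /andP[+ _].
  lra.
have Kz0 j : 0 <= 2 * K * nsq (z j) by rewrite !mulr_ge0.
apply: le_trans (wsum_ends Kz0 mN _) _.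
  move=> n /andP[mn nN]; apply: le_trans (energy n (ltnW nN)).
  rewrite ler_pM2l //; apply: le_trans (wsum_mono z0 mn).
  exact: (le_wsum z0).
rewrite wsumZ; have := ler_wpM2l K_ge0 HA; lra.
Qed.

(** The truncated solutions on growing windows converge pointwise: the difference of two of them is
    homogeneous on the smaller window, so [homogeneous_decay] gives a Cauchy rate. The linear
    recursion and the window bounds pass to the limit. *)
Lemma dichotomy_solution : exists2 C, 0 <= C & forall h B,
  (forall N, wsum (fun i => nsq (h i)) N <= B) ->
  exists2 x, (forall i, x (i + 1) = app (P i) (x i) + h i) &
    forall N, wsum (fun i => nsq (x i)) N <= C * B.
Proof.
have [C C0 HC] := energy_window; exists (2 * C / eta).
  by rewrite divr_ge0 ?mulr_ge0 // ltW.
move=> h B HB.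
set A := _ * B.
have /choice[X HX] : forall N, exists x : int -> R * R,
    solves_on N.+1 h x /\ wsum (fun i => nsq (x i)) N.+1 <= A.
  move=> N; have [x [xs xp xn]] := truncated_solution h (ltn0Sn N).
  exists x; split=> //.
  (* The end signs from [truncated_solution] make the boundary terms nonpositive, leaving a bound
     uniform in [N]. *)
  rewrite /A -(ler_pM2l eta_gt0).
  have -> : eta * (2 * C / eta * B) = 2 * (C * B) by field; rewrite gt_eqF.
  have := HC _ _ _ xs; have := ler_wpM2l C0 (HB N.+1); lra.
have X0 N j : 0 <= nsq (X N j) by exact: nsq_ge0.
have XA N m : (m <= N.+1)%N -> wsum (fun i => nsq (X N i)) m <= A.
  by move=> mN; apply: le_trans (wsum_mono (X0 N) mN) (HX N).2.
have diff N M m (i : int) : (m <= N <= M)%N -> - m%:Z <= i < m%:Z ->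
    eta * nsq (X M i - X N i) * (N - m)%:R <= 16 * K * A.
  move=> /andP[mN NM] im.
  have zs : solves_on N.+1 (fun=> 0) (fun i => X M i - X N i).
    move=> j Hj; rewrite addr0 (HX M).1 ?(HX N).1 //; last by lia.
    by rewrite appB opprD addrACA subrr addr0.
  have zA : wsum (fun i => nsq (X M i - X N i)) N.+1 <= 4 * A.
    apply: (@le_trans _ _ (wsum (fun i => 2 * nsq (X M i) + 2 * nsq (X N i)) N.+1)).
      by apply: ler_wsum => j _; exact: nsqB_le.
    by rewrite wsumD !wsumZ; have := XA M N.+1 NM; have := XA N N.+1 (leqnn _); lra.
  by have := homogeneous_decay zs zA mN im; lra.
(* [p] stands for either coordinate projection. *)
have cvgX (p : R * R -> R) i : (forall x y : R * R, (p x - p y) ^+ 2 <= nsq (x - y)) ->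
    cvgn (fun N => p (X N i)).
  move=> Hp; apply: cauchy_rate_cvg => e e0.
  have [k kA] := exists_nat_gt (16 * K * A / (eta * e ^+ 2)).
  pose m := `|i|%N.+1; exists (m + k)%N => n mn.
  have im : - m%:Z <= i < m%:Z by lia.
  have := @diff (m + k)%N n m i; rewrite leq_addr mn => /(_ isT im).
  have ee : 0 < e ^+ 2 by rewrite exprn_gt0.
  move: kA; rewrite addKn ltr_pdivrMr ?mulr_gt0 // => kA le.
  rewrite -(@ler_sqr _ `|_| e) ?nnegrE ?(ltW e0) // real_normK ?num_real //.
  apply: le_trans (Hp _ _) _; rewrite leNgt; apply/negP => lt.
  have k0 : 0 <= k%:R :> R by rewrite ler0n.
  have := ler_wpM2l (mulr_ge0 (ltW eta_gt0) k0) (ltW lt); lra.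
have c1 i : cvgn (fun N => (X N i).1).
  by apply: cvgX => x y; rewrite /nsq /= lerDl sqr_ge0.
have c2 i : cvgn (fun N => (X N i).2).
  by apply: cvgX => x y; rewrite /nsq /= lerDr sqr_ge0.
pose x i := (limn (fun N => (X N i).1), limn (fun N => (X N i).2)) : R * R.
have x1 i : ((X N i).1 @[N --> \oo] --> (x i).1)%classic by exact: c1.
have x2 i : ((X N i).2 @[N --> \oo] --> (x i).2)%classic by exact: c2.
have step i : (\forall N \near \oo, X N (i + 1) = app (P i) (X N i) + h i)%classic.
  exists `|i|%N => // N /= iN; apply: (HX N).1; lia.
have lin (a b c : R) i : (a * (X N i).1 + b * (X N i).2 + c @[N --> \oo]
    --> a * (x i).1 + b * (x i).2 + c)%classic.
  apply: cvgD; last exact: cvg_cst.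
  by apply: cvgD; apply: cvgM => //; exact: cvg_cst.
exists x.
  move=> i; rewrite [LHS]surjective_pairing [RHS]surjective_pairing; congr pair.
    rewrite -[LHS](cvg_lim (@Rhausdorff R) (x1 (i + 1))).
    apply: cvg_lim; first exact: Rhausdorff.
    apply: cvg_trans (lin (P i 0 0) (P i 0 1) (h i).1 i).
    by apply: near_eq_cvg; near=> N; rewrite (near (step i) N).
  rewrite -[LHS](cvg_lim (@Rhausdorff R) (x2 (i + 1))).
  apply: cvg_lim; first exact: Rhausdorff.
  apply: cvg_trans (lin (P i 1 0) (P i 1 1) (h i).2 i).
  by apply: near_eq_cvg; near=> N; rewrite (near (step i) N).
move=> m.
have cw : (wsum (fun i => nsq (X n i)) m @[n --> \oo] --> wsum (fun i => nsq (x i)) m)%classic.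
  apply: cvg_wsum => i; apply: cvgD; rewrite expr2.
    by under eq_fun do rewrite expr2; apply: cvgM.
  by under eq_fun do rewrite expr2; apply: cvgM.
rewrite -(cvg_lim _ cw) //; apply: limr_le; first by apply/cvg_ex; eexists; exact: cw.
by exists m => // N /= mN; apply: XA; rewrite leqW.
Unshelve. all: by end_near.
Qed.

End Dichotomy.

(** * The Jacobi equation as a first-order system *)

Section SquareSummable.
Variable R : realType.
Implicit Types (u : int -> R) (A : R).

Lemma sqr_int_ge0 u i : 0 <= u i ^+ 2.
Proof. exact: sqr_ge0. Qed.

Lemma wsum_nondecreasing u :
  {homo wsum (fun i => u i ^+ 2) : n m / (n <= m)%N >-> n <= m}.
Proof. by move=> n m; apply: wsum_mono => i; exact: sqr_ge0. Qed.

(** [series (sq_terms u)] is convertible to the window sums of [u i ^+ 2], which increase to the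
    squared norm. *)
Lemma wsum_le_l2_norm u : in_l2 u ->
  forall N, wsum (fun i => u i ^+ 2) N <= l2_norm u ^+ 2.
Proof.
move=> u2 N; rewrite /l2_norm sqr_sqrtr.
  exact: nondecreasing_cvgn_le (@wsum_nondecreasing u) u2 N.
apply: limr_ge; first exact: u2.
exists 0%N => // n _.
exact: (@wsum_ge0 _ (fun i => u i ^+ 2) n (fun i => sqr_ge0 (u i))).
Qed.

Lemma in_l2_wsum u A : (forall N, wsum (fun i => u i ^+ 2) N <= A) -> in_l2 u.
Proof.
move=> uA; apply: nondecreasing_is_cvgn; first exact: wsum_nondecreasing.
by exists A => _ [N _ <-]; exact: uA.
Qed.

Lemma l2_norm_le u A : (forall N, wsum (fun i => u i ^+ 2) N <= A) ->
  l2_norm u <= Num.sqrt A.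
Proof.
move=> uA; rewrite ler_wsqrtr //; apply: limr_le; first exact: in_l2_wsum uA.
by exists 0%N => // n _; exact: uA.
Qed.

Lemma l2_norm_ge0 u : 0 <= l2_norm u.
Proof. exact: sqrtr_ge0. Qed.

End SquareSummable.

Section JacobiSystem.
Variables (R : realType) (D : nat) (B : 'I_D -> seq (resonator R)).
Variables (chi : int -> 'I_D) (lam : R).
Local Notation vv := (vv B chi).
Local Notation ll := (ll B chi).
Local Notation ss := (ss B chi).
Local Notation J := (jacobi B chi).
Hypothesis res_gt0 : forall i, [/\ 0 < vv i, 0 < ll i & 0 < ss i].
Implicit Types (u f : int -> R) (x : int -> R * R).

Definition prop_at i : 'M[R]_2 := Pmat lam (res_seq B chi i).
Definition kap i : R := vv i / Num.sqrt (ll i).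
Definition field_of u i : R := kap i * u i.
Definition state u i : R * R :=
  (field_of u i, (field_of u i - field_of u (i - 1)) / ss (i - 1)).
(** The source [f i] changes the flux [psi] by [- f i / kap i], and then the field through
    [phi_(i+1) = phi_i + s_i psi_(i+1)]; hence the direction [(s_i, 1)]. *)
Definition force f i : R * R := scl (- (f i / kap i)) (ss i, 1).

Lemma kap_gt0 i : 0 < kap i.
Proof. by have [v0 l0 _] := res_gt0 i; rewrite divr_gt0 // sqrtr_gt0. Qed.

Lemma app_prop i (y : R * R) : app (prop_at i) y =
  (y.1 + ss i * (y.2 - lam * y.1 / kap i ^+ 2), y.2 - lam * y.1 / kap i ^+ 2).
Proof.
have [v0 l0 s0] := res_gt0 i.
have kE : (kap i ^+ 2)^-1 = ll i / vv i ^+ 2.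
  by rewrite expr_div_n sqr_sqrtr ?ltW // invf_div.
rewrite kE /app /prop_at /Pmat !mxE /= -/(vv i) -/(ll i) -/(ss i).
by congr pair; field; rewrite gt_eqF.
Qed.

(** Divergence form of the operator, since [a_i = - kap_i kap_(i+1) / s_i] and
    [b_i = kap_i^2 (1/s_(i-1) + 1/s_i)]. *)
Lemma jacobiE u i : J u i =
  kap i * ((state u i).2 - (state u (i + 1)).2).
Proof.
have [v0 l0 s0] := res_gt0 i; have [v1 l1 s1] := res_gt0 (i + 1).
have [v2 l2 s2] := res_gt0 (i - 1).
rewrite /jacobi /jac_a /jac_b subrK /state [in RHS]/snd addrK /field_of /kap.
rewrite !sqrtrM ?ltW //.
have := sqr_sqrtr (ltW l0).
have : 0 < Num.sqrt (ll i) by rewrite sqrtr_gt0.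
have : 0 < Num.sqrt (ll (i + 1)) by rewrite sqrtr_gt0.
have : 0 < Num.sqrt (ll (i - 1)) by rewrite sqrtr_gt0.
(* Naming the roots and replacing [ll i] by the square of its root leaves a rational identity. *)
move: (Num.sqrt (ll i)) (Num.sqrt (ll (i + 1))) (Num.sqrt (ll (i - 1))).
move=> a b c c0 b0 a0 <-.
by field; rewrite !gt_eqF.
Qed.

Lemma state_step u f i : J u i - lam * u i = f i ->
  state u (i + 1) = app (prop_at i) (state u i) + force f i.
Proof.
rewrite jacobiE app_prop /force => <-.
have k0 := kap_gt0 i; have [_ _ s0] := res_gt0 i.
have E : (state u (i + 1)).1 = (state u i).1 + ss i * (state u (i + 1)).2.
  by rewrite /state /fst /snd addrK; field; rewrite gt_eqF.
have F : lam * u i = lam * (state u i).1 / kap i.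
  by rewrite /state /field_of /=; field; rewrite gt_eqF.
rewrite [LHS]surjective_pairing E {}F /scl.
move: (state u i) (state u (i + 1)).2 => [p q] r /=.
by congr pair => /=; field; rewrite gt_eqF.
Qed.

(** The recursion at [i - 1] shows that the second component of [x] is the difference quotient of
    the first, so [x] agrees with the state of [u]. *)
Lemma state_unstep x f :
  (forall i, x (i + 1) = app (prop_at i) (x i) + force f i) ->
  forall i, J (fun i => (x i).1 / kap i) i - lam * ((x i).1 / kap i) = f i.
Proof.
move=> Hx; set u := fun i => _.
have fE i : field_of u i = (x i).1.
  by rewrite /field_of /u mulrC divfK // gt_eqF // kap_gt0.
have sE i : (state u i).2 = (x i).2.
  rewrite /state /= !fE; have := Hx (i - 1); rewrite subrK app_prop => ->.
  have k0 := kap_gt0 (i - 1); have [_ _ s0] := res_gt0 (i - 1).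
  by rewrite /force /scl /=; field; rewrite !gt_eqF.
move=> i; rewrite jacobiE !sE Hx app_prop /u /=.
have k0 := kap_gt0 i; by field; rewrite gt_eqF.
Qed.

Variable K : R.
Hypothesis K_bnd : forall i,
  [/\ kap i <= K, (kap i)^-1 <= K, ss i <= K & (ss i)^-1 <= K].

Let K_ge0 : 0 <= K.
Proof. by have [H _ _ _] := K_bnd 0; apply: le_trans H; exact: ltW (kap_gt0 0). Qed.

Let sqrK (z : R) : 0 <= z -> z <= K -> z ^+ 2 <= K ^+ 2.
Proof. by move=> z0 zK; rewrite ler_sqr // nnegrE. Qed.

Lemma state_bound u A : (forall N, wsum (fun i => u i ^+ 2) N <= A) ->
  forall N, wsum (fun i => nsq (state u i)) N <= (K ^+ 2 + 4 * K ^+ 4) * A.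
Proof.
move=> uA N.
have b i : nsq (state u i) <= (K ^+ 2 + 2 * K ^+ 4) * u i ^+ 2
    + 2 * K ^+ 4 * u (i - 1) ^+ 2.
  have fb j : field_of u j ^+ 2 <= K ^+ 2 * u j ^+ 2.
    have [kb _ _ _] := K_bnd j.
    rewrite /field_of exprMn ler_wpM2r ?sqr_ge0 // sqrK //.
    exact: ltW (kap_gt0 j).
  have sb : (ss (i - 1))^-1 ^+ 2 <= K ^+ 2.
    have [_ _ s0] := res_gt0 (i - 1).
    have [_ _ _ sb] := K_bnd (i - 1).
    by rewrite sqrK // invr_ge0 ltW.
  rewrite /nsq /= [(_ / _) ^+ 2]exprMn.
  have d : (field_of u i - field_of u (i - 1)) ^+ 2
      <= 2 * K ^+ 2 * (u i ^+ 2 + u (i - 1) ^+ 2).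
    have := sqr_ge0 (field_of u i + field_of u (i - 1)).
    by have := fb i; have := fb (i - 1); lra.
  have := ler_pM (sqr_ge0 _) (sqr_ge0 _) d sb; have := fb i; lra.
apply: le_trans (ler_wsum (fun i _ => b i)) _.
rewrite wsumD !wsumZ.
have s1 := le_trans (wsum_shiftl N (sqr_int_ge0 u)) (uA N.+1).
have K2 : 0 <= K ^+ 2 by rewrite sqr_ge0.
have K4 : 0 <= 2 * K ^+ 4 by rewrite mulr_ge0 // exprn_even_ge0.
have := ler_wpM2l (addr_ge0 K2 K4) (uA N); have := ler_wpM2l K4 s1; lra.
Qed.

Lemma force_bound f A : (forall N, wsum (fun i => f i ^+ 2) N <= A) ->
  forall N, wsum (fun i => nsq (force f i)) N <= K ^+ 2 * (K ^+ 2 + 1) * A.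
Proof.
move=> fA N.
have b i : nsq (force f i) <= K ^+ 2 * (K ^+ 2 + 1) * f i ^+ 2.
  have [_ kb sb _] := K_bnd i; have [_ _ s0] := res_gt0 i.
  have -> : nsq (force f i) = (kap i)^-1 ^+ 2 * (ss i ^+ 2 + 1) * f i ^+ 2.
    by rewrite /nsq /force /scl /=; field; rewrite gt_eqF // kap_gt0.
  rewrite ler_wpM2r ?sqr_ge0 // ler_pM ?sqr_ge0 ?addr_ge0 ?sqr_ge0 //.
    by rewrite sqrK // invr_ge0 ltW ?kap_gt0.
  by rewrite lerD2r sqrK // ltW.
apply: le_trans (ler_wsum (fun i _ => b i)) _.
rewrite wsumZ ler_wpM2l // mulr_ge0 ?addr_ge0 ?sqr_ge0 //.
Qed.

Lemma unstate_bound x A : (forall N, wsum (fun i => nsq (x i)) N <= A) ->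
  forall N, wsum (fun i => ((x i).1 / kap i) ^+ 2) N <= K ^+ 2 * A.
Proof.
move=> xA N.
have b i : ((x i).1 / kap i) ^+ 2 <= K ^+ 2 * nsq (x i).
  have [_ kb _ _] := K_bnd i.
  rewrite exprMn mulrC ler_pM ?sqr_ge0 //.
    by rewrite sqrK // invr_ge0 ltW ?kap_gt0.
  by rewrite lerDl sqr_ge0.
apply: le_trans (ler_wsum (fun i _ => b i)) _.
by rewrite wsumZ ler_wpM2l ?sqr_ge0.
Qed.

(** The passage between [u] and its state is bounded both ways, so [apriori_bound] yields the
    estimate [est] and [dichotomy_solution] yields solvability. *)
Lemma dichotomy_in_resolvent (G : int -> 'M[R]_2) (eta : R) :
  (forall i, mxbnd K (prop_at i)) -> (forall i, mxbnd K (G i)) -> 0 < eta ->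
  (forall i y, qf (G i) y + eta * nsq y
                 <= qf (G (i + 1)) (app (prop_at i) y)) ->
  (forall i, exists2 e : R * R, e != 0 & 0 <= qf (G i) e) ->
  (forall i, exists2 e : R * R, e != 0 & qf (G i) e <= 0) ->
  in_resolvent J lam.
Proof.
move=> Pb Gb eta0 Gi Gp Gn.
have [C C0 apri] := apriori_bound Pb Gb eta0 Gi.
have [C' C'0 sol] := dichotomy_solution Pb Gb eta0 Gi Gp Gn.
pose E := K ^+ 2 * (C * (K ^+ 2 * (K ^+ 2 + 1))).
have E0 : 0 <= E.
  by rewrite /E !mulr_ge0 ?addr_ge0 ?sqr_ge0.
have est u f A : in_l2 u -> (forall N, wsum (fun i => f i ^+ 2) N <= A) ->
    (forall i, J u i - lam * u i = f i) ->
    forall N, wsum (fun i => u i ^+ 2) N <= E * A.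
  move=> u2 fA Hu N.
  have xs i := state_step (Hu i).
  have := apri _ _ _ _ xs (state_bound (wsum_le_l2_norm u2)) (force_bound fA).
  move=> /unstate_bound /(_ N).
  have -> : (fun i => ((state u i).1 / kap i) ^+ 2) = (fun i => u i ^+ 2).
    by apply/funext => i; rewrite /= /field_of mulrC mulKf // gt_eqF // kap_gt0.
  by rewrite /E !mulrA.
split; last first.
  exists (Num.sqrt E) => u f u2 f2 Hu.
  rewrite -[l2_norm f]ger0_norm ?l2_norm_ge0 // -sqrtr_sqr -sqrtrM //.
  by apply: l2_norm_le; apply: est Hu => //; exact: wsum_le_l2_norm.
move=> f f2.
have [x xs xb] := sol _ _ (force_bound (wsum_le_l2_norm f2)).
have u2 := in_l2_wsum (unstate_bound xb).
exists (fun i => (x i).1 / kap i); split=> //; first exact: state_unstep.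
move=> w w2 Hw; apply/funext => i.
set u := fun i => _ in u2 *.
(* Uniqueness: the difference of two solutions has zero source, and [est] with bound 0 makes it
   vanish. *)
have d2 : in_l2 (fun i => w i - u i).
  apply: (@in_l2_wsum _ _ (2 * l2_norm w ^+ 2 + 2 * l2_norm u ^+ 2)) => N.
  apply: (@le_trans _ _ (wsum (fun i => 2 * w i ^+ 2 + 2 * u i ^+ 2) N)).
    apply: ler_wsum => j _; have := sqr_ge0 (w j + u j); lra.
  rewrite wsumD !wsumZ.
  have := wsum_le_l2_norm u2 N; have := wsum_le_l2_norm w2 N; lra.
have dJ j : J (fun i => w i - u i) j - lam * (w j - u j) = 0.
  have : J u j - lam * u j = f j by exact: state_unstep.
  have := Hw j; rewrite /jacobi; lra.
have z N : wsum (fun i : int => 0 ^+ 2) N <= (0 : R).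
  by rewrite /wsum big1 // => n _; rewrite expr0n addr0.
have := est _ (fun=> 0) 0 d2 z dJ `|i|%N.+1; rewrite mulr0.
have : - (`|i|%N.+1)%:Z <= i < (`|i|%N.+1)%:Z by lia.
move=> /(le_wsum (sqr_int_ge0 (fun i => w i - u i))) /= le1 /(le_trans le1).
rewrite real_exprn_even_le0 ?num_real //= subr_eq0 => /eqP ->.
by [].
Qed.

End JacobiSystem.

(** * Propagation matrices *)

Section UnimodularMaps.
Variable R : realType.
Implicit Types (M : 'M[R]_2) (x y : R * R).

Lemma app0 M : app M 0 = 0.
Proof. by rewrite /app /= !mulr0 addr0. Qed.

(** For determinant 1 the inverse is the adjugate, written out here. *)
Lemma app_inv M y : \det M = 1 ->
  app M (M 1 1 * y.1 - M 0 1 * y.2, M 0 0 * y.2 - M 1 0 * y.1) = y.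
Proof.
rewrite det_mx2 => M1; rewrite [RHS]surjective_pairing /app /=; congr pair.
  by rewrite -[RHS]mul1r -M1; ring.
by rewrite -[RHS]mul1r -M1; ring.
Qed.

Lemma app_neq0 M x : \det M = 1 -> x != 0 -> app M x != 0.
Proof.
rewrite det_mx2 => M1; apply: contra_neq => Mx0.
have : app (mx2 (M 1 1) (- M 0 1) (- M 1 0) (M 0 0)) (app M x) = x.
  rewrite /app !mxE /= [RHS]surjective_pairing; congr pair;
    by rewrite -[RHS]mul1r -M1; ring.
by rewrite Mx0 app0.
Qed.

Lemma app_surj M y : \det M = 1 -> y != 0 -> exists2 x, x != 0 & app M x = y.
Proof.
move=> M1 y0; eexists; last exact: app_inv M1.
by apply: contra_neq y0 => x0; rewrite -(app_inv y M1) x0 app0.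
Qed.

Lemma det_Pmat lam (r : resonator R) : \det (Pmat lam r) = 1.
Proof. by rewrite det_mx2 !mxE /=; ring. Qed.

(** The fold multiplies later resonators on the left; factoring out the accumulator allows the
    product to be peeled from its first resonator as well. *)
Lemma block_prop_foldl lam (b : seq (resonator R)) M :
  foldl (fun M r => Pmat lam r *m M) M b = block_prop lam b *m M.
Proof.
rewrite /block_prop; elim/last_ind: b M => [|b r IH] M; first by rewrite mul1mx.
by rewrite !foldl_rcons IH mulmxA.
Qed.

Lemma app_block_cons lam r (b : seq (resonator R)) y :
  app (block_prop lam (r :: b)) y = app (block_prop lam b) (app (Pmat lam r) y).
Proof. by rewrite /block_prop /= block_prop_foldl mulmx1 appM. Qed.

Lemma app_block_rcons lam r (b : seq (resonator R)) y :
  app (block_prop lam (rcons b r)) y = app (Pmat lam r) (app (block_prop lam b) y).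
Proof. by rewrite /block_prop foldl_rcons appM. Qed.

Lemma det_block_prop lam (b : seq (resonator R)) : \det (block_prop lam b) = 1.
Proof.
rewrite /block_prop; elim/last_ind: b => [|b r IH]; first by rewrite det1.
by rewrite foldl_rcons det_mulmx IH det_Pmat mulr1.
Qed.

End UnimodularMaps.

(** * Positions in the concatenation of blocks *)

Section Positions.
Variables (R : realType) (D : nat) (B : 'I_D -> seq (resonator R)).
Variable chi : int -> 'I_D.
Hypothesis B_gt0 : forall d, (0 < size (B d))%N.
Implicit Types (p : int * nat) (i j : int) (k n m : nat).

Definition bsize j := size (B (chi j)).
Definition next_pos p : int * nat :=
  if (p.2.+1 < bsize p.1)%N then (p.1, p.2.+1) else (p.1 + 1, 0%N).
Definition prev_pos p : int * nat :=
  if p.2 is k.+1 then (p.1, k) else (p.1 - 1, (bsize (p.1 - 1)).-1).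
(** Index [i] is encoded as a pair of block index and offset. Iterating a successor and its inverse
    replaces the two fuelled walks of [res_seq] by one step rule, [pos_step], valid for all
    integers. *)
Definition pos i : int * nat :=
  match i with
  | Posz n => iter n next_pos (0, 0%N)
  | Negz n => iter n.+1 prev_pos (0, 0%N)
  end.
Definition res_at p := nth (dflt_res R) (B (chi p.1)) p.2.
Definition valid_pos p := (p.2 < bsize p.1)%N.

Let bsize_gt0 j : (0 < bsize j)%N. Proof. exact: B_gt0. Qed.

Lemma next_pos_valid p : valid_pos (next_pos p).
Proof. by rewrite /valid_pos /next_pos; case: ifP. Qed.

Lemma prev_pos_valid p : valid_pos p -> valid_pos (prev_pos p).
Proof.
case: p => j [|k]; rewrite /valid_pos /prev_pos /= => H; last exact: ltnW.
by rewrite prednK // bsize_gt0.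
Qed.

Lemma prev_posK p : valid_pos p -> next_pos (prev_pos p) = p.
Proof.
case: p => j [|k]; rewrite /valid_pos /prev_pos /next_pos /= => H.
  by rewrite prednK ?bsize_gt0 // ltnn subrK.
by rewrite H.
Qed.

Lemma next_posK p : valid_pos p -> prev_pos (next_pos p) = p.
Proof.
case: p => j k; rewrite /valid_pos /next_pos /= => H; case: ifP => // lt.
rewrite /prev_pos /snd /fst addrK; congr pair; have := bsize_gt0 j; lia.
Qed.

Lemma pos_valid i : valid_pos (pos i).
Proof.
case: i => n /=; first by case: n => [|n]; [exact: bsize_gt0|exact: next_pos_valid].
elim: n => [|n IH]; apply: prev_pos_valid => //; exact: bsize_gt0.
Qed.

Lemma pos_step i : pos (i + 1) = next_pos (pos i).
Proof.
case: i => [n|[|n]].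
- by have -> : Posz n + 1 = n.+1 by lia.
- by rewrite [in RHS]/= prev_posK //; exact: bsize_gt0.
have -> : Negz n.+1 + 1 = Negz n by lia.
by rewrite [in RHS]/= -[prev_pos (iter n _ _)]/(pos (Negz n)) prev_posK // pos_valid.
Qed.

Lemma pos_addn i n : pos (i + n%:Z) = iter n next_pos (pos i).
Proof.
elim: n => [|n IH]; first by rewrite addr0.
by rewrite /= -IH -pos_step; congr pos; lia.
Qed.

Lemma iter_next_in j n : (n < bsize j)%N -> iter n next_pos (j, 0%N) = (j, n).
Proof.
elim: n => //= n IH lt; rewrite IH; last exact: ltnW.
by rewrite /next_pos /= lt.
Qed.

Lemma iter_next_block j : iter (bsize j) next_pos (j, 0%N) = (j + 1, 0%N).
Proof.
rewrite -(prednK (bsize_gt0 j)) /= iter_next_in ?prednK ?bsize_gt0 //.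
by rewrite /next_pos /= prednK ?bsize_gt0 // ltnn.
Qed.

Lemma iter_prev_in j m : (m < bsize j)%N ->
  iter m prev_pos (j, (bsize j).-1) = (j, bsize j - 1 - m)%N.
Proof.
elim: m => [|m IH] lt /=; first by rewrite subn0 subn1.
rewrite IH; last exact: ltnW.
by have -> : (bsize j - 1 - m = (bsize j - 1 - m.+1).+1)%N by lia.
Qed.

Lemma iter_prev_block j :
  iter (bsize j) prev_pos (j, (bsize j).-1) = (j - 1, (bsize (j - 1)).-1).
Proof.
have := bsize_gt0 j => b0.
have -> : bsize j = (bsize j).-1.+1 by rewrite prednK.
rewrite [iter _ _ _]/= iter_prev_in; last by rewrite prednK.
by rewrite subn1 subnn.
Qed.

Lemma res_fwdE fuel j n : (n < fuel)%N ->
  res_fwd B chi fuel j n = res_at (iter n next_pos (j, 0%N)).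
Proof.
elim: fuel j n => // fuel IH j n nf /=; rewrite -/(bsize j).
case: ifP => lt; first by rewrite iter_next_in.
have b0 := bsize_gt0 j; rewrite IH; last by lia.
have {2}-> : n = (n - bsize j + bsize j)%N by lia.
by rewrite iterD iter_next_block.
Qed.

Lemma res_bwdE fuel j m : (m < fuel)%N ->
  res_bwd B chi fuel j m = res_at (iter m prev_pos (j, (bsize j).-1)).
Proof.
elim: fuel j m => // fuel IH j m mf /=; rewrite -/(bsize j).
case: ifP => lt; first by rewrite iter_prev_in.
have b0 := bsize_gt0 j; rewrite IH; last by lia.
have {2}-> : m = (m - bsize j + bsize j)%N by lia.
by rewrite iterD iter_prev_block.
Qed.

Lemma res_seqE i : res_seq B chi i = res_at (pos i).
Proof.
case: i => n; rewrite /res_seq; first exact: res_fwdE.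
have -> : (0 <= Negz n) = false by lia.
have -> : absz (- Negz n - 1) = n by lia.
by rewrite res_bwdE // [pos _]iterSr.
Qed.

Lemma pos_block_start j : exists i, pos i = (j, 0%N).
Proof.
elim/int_rect: j => [|n [i Hi]|n [i Hi]].
- by exists 0.
- exists (i + (bsize n)%:Z); rewrite pos_addn Hi iter_next_block.
  by congr pair; lia.
have -> : - n.+1%:Z = - n%:Z - 1 by lia.
(* Of the [L] steps back from a block start, the first lands on the last resonator of the preceding
   block and the other [L - 1] reach its start. *)
pose L := bsize (- n%:Z - 1); exists (i - L%:Z).
have L0 : (0 < L)%N by exact: bsize_gt0.
have prevE a : pos (a - 1) = prev_pos (pos a).
  by rewrite -[in RHS](subrK 1 a) pos_step next_posK // pos_valid.
have pos_subn m : pos (i - m%:Z) = iter m prev_pos (pos i).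
  elim: m => [|m IH]; first by rewrite subr0.
  by rewrite [RHS]/= -IH -prevE; congr pos; lia.
rewrite pos_subn Hi -(prednK L0) iterSr [prev_pos _]/=.
rewrite -/L iter_prev_in ?prednK //; congr pair.
by rewrite -/L; lia.
Qed.

End Positions.

(** * A Lyapunov form along the resonator sequence *)

Section Uniform.
Variable R : realType.

Lemma fin_bound (T : finType) (F : T -> R) :
  exists2 K, 0 <= K & forall t, F t <= K.
Proof.
(* The sum of absolute values is a bound even when [T] is empty. *)
exists (\sum_t `|F t|) => [|t]; first by apply: sumr_ge0.
by rewrite (bigD1 t) //= (le_trans (ler_norm _)) // lerDl sumr_ge0.
Qed.

Lemma fin_bound_nat (D : nat) (s : 'I_D -> nat) (F : 'I_D -> nat -> R) :
  exists2 K, 0 <= K & forall d k, (k < s d)%N -> F d k <= K.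
Proof.
have [K K0 HK] := fin_bound (fun d => \sum_(0 <= k < s d) `|F d k|).
exists K => // d k kd; apply: le_trans (HK d).
rewrite big_mkord (bigD1 (Ordinal kd)) //= (le_trans (ler_norm _)) // lerDl.
exact: sumr_ge0.
Qed.

Lemma fin_gap (T : finType) (F : T -> R) : (forall t, 0 < F t) ->
  exists2 e, 0 < e & forall t, e <= F t.
Proof.
move=> F0; have [K K0 HK] := fin_bound (fun t => (F t)^-1).
exists (K + 1)^-1 => [|t]; first by rewrite invr_gt0; lra.
rewrite -[F t]invrK lef_pV2 ?posrE ?invr_gt0 //; last by lra.
by have := HK t; lra.
Qed.

End Uniform.

(** * Pulling a form back through a block *)

Section BlockLyapunov.
Variables (R : realType) (lam : R) (Q : 'M[R]_2).
Implicit Types (b : seq (resonator R)) (y : R * R).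

(* [Q] pulled back through the block, minus [eta] times the squared norms of
   the states met on the way: this makes the form gain [eta * nsq] at every
   resonator instead of only once per block. *)
Fixpoint lyap (eta : R) b : 'M[R]_2 :=
  if b is r :: b' then (Pmat lam r)^T *m lyap eta b' *m Pmat lam r - eta%:M
  else Q.

Lemma lyap_cons eta r b y : qf (lyap eta (r :: b)) y
  = qf (lyap eta b) (app (Pmat lam r) y) - eta * nsq y.
Proof. exact: qf_pull. Qed.

(** The subtracted terms are [eta] times squared norms of intermediate states, each bounded by a
    multiple of [nsq y]. As [c] does not depend on [eta], the total loss can later be kept below the
    gain of a block. *)
Lemma lyap_ge b : exists2 c, 0 <= c & forall eta y, 0 <= eta ->
  qf Q (app (block_prop lam b) y) - eta * c * nsq y <= qf (lyap eta b) y.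
Proof.
elim: b => [|r b [c c0 IH]].
  by exists 0 => // eta y _; rewrite /block_prop /= app1 mulr0 mul0r subr0.
have [K K0 HK] : exists2 K, 0 <= K & forall y, nsq (app (Pmat lam r) y) <= K * nsq y.
  have [K K0 HK] := fin_bound (fun ij : 'I_2 * 'I_2 => `|Pmat lam r ij.1 ij.2|).
  exists (4 * K ^+ 2) => [|y]; first by rewrite mulr_ge0 // sqr_ge0.
  by apply: app_bound => i j; exact: HK (i, j).
exists (c * K + 1) => [|eta y e0]; first by have := mulr_ge0 c0 K0; lra.
rewrite lyap_cons app_block_cons.
have := IH eta (app (Pmat lam r) y) e0.
have := ler_wpM2l (mulr_ge0 e0 c0) (HK y); lra.
Qed.

(** Each pull-back only lowers the form, so preimages of a nonpositive vector under the invertible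
    resonator maps stay nonpositive. *)
Lemma lyap_neg eta b e : 0 <= eta -> e != 0 -> qf Q e <= 0 ->
  exists2 e', e' != 0 & qf (lyap eta b) e' <= 0.
Proof.
move=> eta0 e0 qe; elim: b => [|r b [f f0 qf0]]; first by exists e.
have [g g0 Hg] := app_surj (det_Pmat lam r) f0.
exists g => //; rewrite lyap_cons Hg.
have := mulr_ge0 eta0 (nsq_ge0 g); lra.
Qed.

(** Moving forward past a resonator removes a subtracted term, so the image of a nonnegative vector
    stays nonnegative. *)
Lemma lyap_pos eta b k e : 0 <= eta -> (k <= size b)%N -> e != 0 ->
  0 <= qf (lyap eta b) e -> exists2 e', e' != 0 & 0 <= qf (lyap eta (drop k b)) e'.
Proof.
move=> eta0; elim: b k e => [|r b IH] [|k] e //=; try by move=> *; exists e.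
rewrite ltnS => kb e0; rewrite -/(lyap eta (r :: b)) lyap_cons => qe.
apply: (IH k (app (Pmat lam r) e)) => //; first by rewrite app_neq0 // det_Pmat.
have := mulr_ge0 eta0 (nsq_ge0 e); lra.
Qed.

End BlockLyapunov.

Section ResonatorBounds.
Variables (R : realType) (D : nat) (B : 'I_D -> seq (resonator R)).
Variables (chi : int -> 'I_D) (lam : R).
Hypothesis blocks : forall d, is_block (B d).

Let B_gt0 d : (0 < size (B d))%N. Proof. by case: (blocks d). Qed.

Lemma res_seq_in i : exists2 p, res_seq B chi i = nth (dflt_res R) (B p.1) p.2
  & (p.2 < size (B p.1))%N.
Proof.
exists (chi (pos B chi i).1, (pos B chi i).2); first exact: res_seqE.
exact: (@pos_valid _ _ B chi).
Qed.

Lemma res_seq_gt0 i :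
  [/\ 0 < vv B chi i, 0 < ll B chi i & 0 < ss B chi i].
Proof.
have [[d k] /= E kd] := res_seq_in i.
by rewrite /vv /ll /ss E; apply: (blocks d).2; rewrite mem_nth.
Qed.

Lemma res_seq_bound (F : resonator R -> R) :
  exists2 K, 0 <= K & forall i, F (res_seq B chi i) <= K.
Proof.
have [K K0 HK] := fin_bound_nat (fun d => size (B d))
  (fun d k => F (nth (dflt_res R) (B d) k)).
exists K => // i; have [[d k] /= -> kd] := res_seq_in i; exact: HK.
Qed.

Lemma jacobi_bounds : exists K, [/\ 0 <= K,
  forall i, [/\ kap B chi i <= K, (kap B chi i)^-1 <= K,
                ss B chi i <= K & (ss B chi i)^-1 <= K]
  & forall i, mxbnd K (prop_at B chi lam i)].
Proof.
pose kp (r : resonator R) := rv r / Num.sqrt (rl r).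
have [K1 K10 H1] := res_seq_bound kp.
have [K2 K20 H2] := res_seq_bound (fun r => (kp r)^-1).
have [K3 K30 H3] := res_seq_bound (@rs R).
have [K4 K40 H4] := res_seq_bound (fun r => (rs r)^-1).
have [K5 K50 H5] := res_seq_bound
  (fun r => \sum_(ij : 'I_2 * 'I_2) `|Pmat lam r ij.1 ij.2|).
exists (K1 + K2 + K3 + K4 + K5); split=> [|i|i a b].
- lra.
- have := H1 i; have := H2 i; have := H3 i; have := H4 i.
  rewrite /kp -/(vv B chi i) -/(ll B chi i) -/(ss B chi i) -/(kap B chi i).
  by move=> *; split; lra.
apply: (@le_trans _ _ K5); last by lra.
apply: le_trans (H5 i); rewrite (bigD1 (a, b)) //= lerDl.
exact: sumr_ge0.
Qed.

Theorem form_in_resolvent (Q : 'M[R]_2) (eps : R) (e f : R * R) : 0 < eps ->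
  (forall d y, qf Q y + eps * nsq y <= qf Q (app (block_prop lam (B d)) y)) ->
  e != 0 -> 0 <= qf Q e -> f != 0 -> qf Q f <= 0 ->
  in_resolvent (jacobi B chi) lam.
Proof.
move=> eps0 HQ e0 qe f0 qf0.
have /choice[c Hc] : forall d, exists c, 0 <= c /\ forall eta y, 0 <= eta ->
    qf Q (app (block_prop lam (B d)) y) - eta * c * nsq y
      <= qf (lyap lam Q eta (B d)) y.
  by move=> d; have [c c0 H] := lyap_ge lam Q (B d); exists c.
have [C C0 HC] := fin_bound c.
(* Chosen so that [eta * c d <= eps]: the loss inside any block is covered by its gain, which gives
   [entry]. *)
pose eta := eps / (C + 1).
have C1 : 0 < C + 1 by lra.
have eta0 : 0 < eta by rewrite divr_gt0.
have entry d y : qf Q y <= qf (lyap lam Q eta (B d)) y.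
  apply: le_trans ((Hc d).2 eta y (ltW eta0)).
  have : eta * c d <= eps.
    have -> : eps = eta * (C + 1) by rewrite /eta divfK // gt_eqF.
    by rewrite ler_pM2l //; have := HC d; lra.
  move=> /(ler_wpM2r (nsq_ge0 y)); have := HQ d y; lra.
(* The form at [i] is pulled back through the part of the current block that is still ahead. *)
pose G i := lyap lam Q eta (drop (pos B chi i).2 (B (chi (pos B chi i).1))).
have valid i := pos_valid chi B_gt0 i.
have [K [K0 Kb Pb]] := jacobi_bounds.
have [K' K'0 Kb'] := fin_bound_nat (fun d => size (B d))
  (fun d k => \sum_(ij : 'I_2 * 'I_2) `|lyap lam Q eta (drop k (B d)) ij.1 ij.2|).
have Gb i : mxbnd (K + K') (G i).
  move=> a b; apply: (@le_trans _ _ K'); last by lra.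
  apply: le_trans (Kb' _ _ (valid i)); rewrite (bigD1 (a, b)) //= lerDl.
  exact: sumr_ge0.
apply: (@dichotomy_in_resolvent _ _ B chi lam res_seq_gt0 (K + K') _ G eta) => //.
- by move=> i; have [? ? ? ?] := Kb i; split; lra.
- by move=> i a b; apply: le_trans (Pb i a b) _; lra.
- move=> i y; rewrite /G pos_step // /prop_at res_seqE //.
  move: (pos B chi i) (valid i) => [j k]; rewrite /valid_pos /res_at /=.
  rewrite -/(bsize B chi j) => kj.
  rewrite (drop_nth (dflt_res R)) // lyap_cons subrK.
  (* Inside a block the increment holds by construction of [lyap]. At its last resonator the
     remainder is empty and the form is [Q], which [entry] compares with the form at the start of
     the next block. *)
  rewrite /next_pos /=; case: ifP => //= k1.
  rewrite drop0 drop_oversize; last by move: k1; rewrite /bsize; lia.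
  exact: entry.
- move=> i; apply: (lyap_pos (ltW eta0) (ltnW (valid i)) e0).
  exact: le_trans qe (entry _ _).
by move=> i; exact: lyap_neg (ltW eta0) f0 qf0.
Qed.

End ResonatorBounds.

(** * A separating form from the source-sink condition *)

Section Hyperbolic.
Variable R : realType.
Implicit Types (M Q : 'M[R]_2) (x y a b : R * R).

Lemma eigenvector_exists M mu : \det M = 1 -> mu ^+ 2 - \tr M * mu + 1 = 0 ->
  exists2 x, x != 0 & app M x = scl mu x.
Proof.
rewrite det_mx2 tr_mx2 => M1 mu0.
(* Each row of [M - mu] proposes a vector in its kernel; if both proposals vanish, [M] is scalar and
   any vector serves. *)
have [h0|h] := eqVneq (M 0 1, mu - M 0 0) 0; last first.
  by exists (M 0 1, mu - M 0 0) => //; rewrite /app /scl /=; congr pair; lra.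
have [h01 h00] : M 0 1 = 0 /\ mu - M 0 0 = 0 by case: h0.
have [h1|h] := eqVneq (mu - M 1 1, M 1 0) 0; last first.
  exists (mu - M 1 1, M 1 0) => //; rewrite /app /scl /= h01.
  have -> : mu = M 0 0 by lra.
  by congr pair; lra.
have [h11 h10] : mu - M 1 1 = 0 /\ M 1 0 = 0 by case: h1.
exists (1, 0).
  by rewrite -nsq_eq0 /nsq /= expr1n expr0n addr0 oner_eq0.
rewrite /app /scl /= h01 h10.
have -> : mu = M 0 0 by lra.
by congr pair; lra.
Qed.

Lemma hyperbolic_eigen M : \det M = 1 -> hyperbolic M -> exists a b xi1 xi2,
  [/\ [/\ a != 0, app M a = scl xi1 a & `|xi1| < 1],
      [/\ b != 0, app M b = scl xi2 b & 1 < `|xi2|] & xi1 * xi2 = 1].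
Proof.
move=> M1; rewrite /hyperbolic; set t := \tr M => ht.
have d0 : 0 < t ^+ 2 - 4.
  by rewrite -(real_normK (num_real t)); have := sqr_ge0 (`|t| - 2); nra.
pose s := Num.sqrt (t ^+ 2 - 4).
have s2 : s ^+ 2 = t ^+ 2 - 4 by rewrite sqr_sqrtr // ltW.
have s0 : 0 < s by rewrite sqrtr_gt0.
have [xi2 x2 x2n] : exists2 xi2, xi2 ^+ 2 - t * xi2 + 1 = 0 & 1 < `|xi2|.
  (* The root of the characteristic polynomial with the sign of the trace is the expanding one; its
     inverse is the other root. *)
  move: ht; rewrite lter_normr => /orP[ht|ht].
    exists ((t + s) / 2); first by lra.
    by rewrite lter_normr; apply/orP; left; lra.
  exists ((t - s) / 2); first by lra.
  by rewrite lter_normr; apply/orP; right; lra.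
have x20 : xi2 != 0 by apply: contraTneq x2n => ->; rewrite normr0 ltr10.
have x1 : xi2^-1 ^+ 2 - t * xi2^-1 + 1 = 0.
  have -> : xi2^-1 ^+ 2 - t * xi2^-1 + 1 = (xi2 ^+ 2 - t * xi2 + 1) / xi2 ^+ 2.
    by field.
  by rewrite x2 mul0r.
have [a a0 Ha] := eigenvector_exists M1 x1.
have [b b0 Hb] := eigenvector_exists M1 x2.
exists a, b, xi2^-1, xi2; split; [split=> //| |by rewrite mulVf] => //.
by rewrite normfV invf_lt1 // (lt_trans ltr01).
Qed.

Lemma basis_decomp a b y : wedge a b != 0 ->
  y = scl (wedge y b / wedge a b) a + scl (wedge a y / wedge a b) b.
Proof.
move=> w; rewrite [LHS]surjective_pairing [RHS]surjective_pairing.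
rewrite /scl; congr pair; rewrite /=; move: w; rewrite /wedge => w; by field.
Qed.

Lemma qf_comb Q a b p q : qf Q (scl p a + scl q b) =
  p ^+ 2 * qf Q a + p * q * (qf Q (a + b) - qf Q a - qf Q b) + q ^+ 2 * qf Q b.
Proof. by rewrite /qf /scl /=; ring. Qed.

(* In an eigenbasis the cross term of [Q] is preserved because the eigenvalues
   multiply to 1, so only the two diagonal terms contribute to the increment. *)
Lemma form_increases M Q a b xi1 xi2 : a != 0 -> b != 0 ->
  app M a = scl xi1 a -> app M b = scl xi2 b -> `|xi1| < 1 -> 1 < `|xi2| ->
  xi1 * xi2 = 1 -> qf Q a < 0 -> 0 < qf Q b ->
  exists2 eps, 0 < eps & forall y, qf Q y + eps * nsq y <= qf Q (app M y).
Proof.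
move=> a0 b0 Ma Mb x1 x2 x12 Qa Qb.
have s1 : xi1 ^+ 2 < 1.
  by rewrite -(real_normK (num_real xi1)); have := normr_ge0 xi1; nra.
have s2 : 1 < xi2 ^+ 2.
  by rewrite -(real_normK (num_real xi2)); nra.
(* Parallel vectors would give [Q] the same sign on both. *)
have w : wedge a b != 0.
  apply/eqP => /(wedge_eq0 a0)[t bE].
  have : 0 < t ^+ 2 * qf Q a by rewrite -qf_scl -bE.
  by have := sqr_ge0 t; nra.
pose ka := qf Q a * (xi1 ^+ 2 - 1); pose kb := qf Q b * (xi2 ^+ 2 - 1).
have ka0 : 0 < ka by rewrite /ka nmulr_rgt0 // subr_lt0.
have kb0 : 0 < kb by rewrite /kb mulr_gt0 // subr_gt0.
have na := nsq_gt0 a0; have nb := nsq_gt0 b0.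
(* The factors 2 come from bounding [nsq] of a combination by twice the sum of its two parts; each
   diagonal gain then pays for its own part. *)
pose k := Num.min (ka / (2 * nsq a)) (kb / (2 * nsq b)).
have k_gt0 : 0 < k.
  by rewrite lt_min; apply/andP; split; apply: divr_gt0 => //; apply: mulr_gt0.
exists k => //.
have k1 : k * (2 * nsq a) <= ka by rewrite -ler_pdivlMr ?mulr_gt0 // ge_min lexx.
have k2 : k * (2 * nsq b) <= kb by rewrite -ler_pdivlMr ?mulr_gt0 // ge_min lexx orbT.
have k0 := ltW k_gt0.
move=> y; rewrite (basis_decomp y w).
move: (wedge y b / _) (wedge a y / _) => p q {y}.
have -> : app M (scl p a + scl q b) = scl (p * xi1) a + scl (q * xi2) b.
  by rewrite appD !appZ Ma Mb /scl /= !mulrA.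
rewrite !qf_comb.
have n2 : nsq (scl p a + scl q b) <= 2 * (p ^+ 2 * nsq a) + 2 * (q ^+ 2 * nsq b).
  rewrite /nsq /scl /=.
  have := sqr_ge0 (p * a.1 - q * b.1); have := sqr_ge0 (p * a.2 - q * b.2); lra.
have -> : p * xi1 * (q * xi2) = p * q by rewrite mulrACA x12 mulr1.
have := ler_wpM2l k0 n2.
have := ler_wpM2l (sqr_ge0 p) k1; have := ler_wpM2l (sqr_ge0 q) k2.
rewrite /ka /kb !exprMn; lra.
Qed.

End Hyperbolic.

(** * Quadratic forms on the projective line *)

Section ProjectiveLine.
Variable R : realType.
Implicit Types (M : 'M[R]_2) (x y u v p : R * R).
Local Open Scope classical_set_scope.

Definition colv x : 'cV[R]_2 := \col_i (if i == 0 then x.1 else x.2).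

Lemma colv_neq0 x : x != 0 -> colv x != 0.
Proof.
apply: contra_neq => /matrixP E; have := E 0 0; have := E 1 0.
by rewrite !mxE /=; case: x {E} => ? ? /= -> ->.
Qed.

Lemma mul_colv M x : M *m colv x = colv (app M x).
Proof.
apply/colP => i; rewrite !mxE big_ord_recl big_ord1 !mxE /= /app.
have -> : lift ord0 ord0 = 1 :> 'I_2 by exact: val_inj.
have [->|->] : i = 0 \/ i = 1; last by [].
  by case: i => [[|[|//]]] q; [left|right]; exact: val_inj.
by [].
Qed.

Lemma scale_colv t x : t *: colv x = colv (scl t x).
Proof. by apply/colP => i; rewrite !mxE /=; case: ifP. Qed.

Lemma eigenline_colv M (P : R -> Prop) x xi : x != 0 ->
  app M x = scl xi x -> P xi -> eigenline_pt M P (line_pt (colv x)).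
Proof.
move=> x0 Mx Px; exists (colv x), xi; split=> //; first exact: colv_neq0.
by rewrite mul_colv Mx scale_colv.
Qed.

Lemma line_ptE x : line_pt (colv x) =
  ((x.1 ^+ 2 - x.2 ^+ 2) / nsq x, 2 * x.1 * x.2 / nsq x).
Proof. by rewrite /line_pt !mxE. Qed.

Lemma line_pt_scl t x : t != 0 -> line_pt (colv (scl t x)) = line_pt (colv x).
Proof.
move=> t0; rewrite !line_ptE nsq_scl /scl /=.
have t20 : t ^+ 2 != 0 by rewrite expf_neq0.
have -> : (t * x.1) ^+ 2 - (t * x.2) ^+ 2 = t ^+ 2 * (x.1 ^+ 2 - x.2 ^+ 2).
  by ring.
have -> : 2 * (t * x.1) * (t * x.2) = t ^+ 2 * (2 * x.1 * x.2) by ring.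
by rewrite -!mulf_div divff // !mul1r.
Qed.

(** [line_pt] doubles angles, so [(1 + c, s)] halves the angle of [(c, s)]. It degenerates only at
    [(-1, 0)], the image of the vertical line. *)
Lemma circle_line_pt p : circle p -> exists2 x, x != 0 & p = line_pt (colv x).
Proof.
case: p => c s; rewrite /circle /= => cs.
have [c1|c1] := eqVneq c (-1).
  exists (0, 1); first by rewrite -nsq_eq0 /nsq /= expr1n expr0n add0r oner_eq0.
  have s0 : s = 0 by apply/eqP; rewrite -sqrf_eq0; apply/eqP; move: cs; rewrite c1; lra.
  by rewrite line_ptE /nsq /= s0 c1; congr pair; field.
have c10 : 1 + c != 0 by rewrite addrC -[1]opprK subr_eq0.
have nE : nsq (1 + c, s) = 2 * (1 + c) by rewrite /nsq /=; lra.
exists (1 + c, s); first by rewrite -nsq_eq0 nE mulf_neq0.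
rewrite line_ptE nE /=.
have -> : (1 + c) ^+ 2 - s ^+ 2 = 2 * (1 + c) * c by lra.
by congr pair; field.
Qed.

(** In double-angle coordinates a quadratic form on unit vectors is an affine function, hence
    continuous on the circle. *)
Definition aff M p : R := (M 0 0 + M 1 1) / 2 + (M 0 0 - M 1 1) / 2 * p.1
  + (M 0 1 + M 1 0) / 2 * p.2.

Lemma qf_line_pt M x : x != 0 -> qf M x = nsq x * aff M (line_pt (colv x)).
Proof.
move=> /nsq_gt0; rewrite line_ptE /aff /qf /nsq /= => n0.
by field; rewrite gt_eqF.
Qed.

Lemma continuous_aff M : continuous (aff M).
Proof.
move=> p; apply: cvgD; first apply: cvgD; first exact: cvg_cst.
  by apply: cvgM; [exact: cvg_cst|exact: cvg_fst].
by apply: cvgM; [exact: cvg_cst|exact: cvg_snd].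
Qed.

(** Intermediate value theorem for [aff M] on the connected set: a zero in [C] would lift to a
    vector on which the form vanishes. *)
Lemma qf_same_sign M (C : set (R * R)) x y : connected C -> x != 0 -> y != 0 ->
  C (line_pt (colv x)) -> C (line_pt (colv y)) ->
  (forall z, z != 0 -> C (line_pt (colv z)) -> qf M z != 0) -> C `<=` @circle R ->
  0 < qf M x -> 0 < qf M y.
Proof.
move=> Cc x0 y0 Cx Cy nz CS qx.
have : connected (aff M @` C).
  apply: connected_continuous_connected => //.
  by apply: continuous_subspaceT; exact: continuous_aff.
move=> /connected_intervalP itv.
rewrite ltNge; apply/negP => qy.
move: qx qy; rewrite !qf_line_pt // pmulr_rgt0 ?nsq_gt0 // pmulr_rle0 ?nsq_gt0 // => qx qy.
have [|p Cp p0] := itv _ _ (imageP (aff M) Cy) (imageP (aff M) Cx) 0.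
  by rewrite qy ltW.
have [z z0 pz] := circle_line_pt (CS _ Cp).
have := nz z z0; rewrite -pz => /(_ Cp); rewrite qf_line_pt // -pz p0 mulr0.
by rewrite eqxx.
Qed.

(** Matrix of the product of the linear forms [wedge u] and [wedge v]. It need not be symmetric, as
    [qf] sees only the sum of the off-diagonal entries. *)
Definition wedge_mx u v : 'M[R]_2 :=
  mx2 (u.2 * v.2) (- (u.1 * v.2 + u.2 * v.1)) 0 (u.1 * v.1).

Lemma qf_wedge_mx u v x : qf (wedge_mx u v) x = wedge u x * wedge v x.
Proof. by rewrite /qf /wedge_mx !mxE /= /wedge; ring. Qed.

Lemma qfN M x : qf (- M) x = - qf M x.
Proof. by rewrite /qf !mxE; ring. Qed.

(** The attained minimum of [g] has a positive gap to the finitely many selected values of [f], and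
    the cut is placed half a gap below it. Indices outside [P] get the dummy gap 1. *)
Lemma finite_cut (T : finType) (t0 : T) (f g : T -> R) (P : T -> Prop) :
  (forall i j, P i -> f i < g j) ->
  exists al, (forall i, P i -> f i < al) /\ forall j, al < g j.
Proof.
move=> H.
have [m Hm] : exists m, forall j, g m <= g j.
  case: (@Order.TotalTheory.arg_minP _ _ _ t0 predT g isT) => m _ Hm.
  by exists m => j; exact: Hm.
have [|e e0 He] := @fin_gap R T (fun i => if `[< P i >] then g m - f i else 1).
  by move=> i; case: asboolP => // Pi; rewrite subr_gt0 H.
exists (g m - e / 2); split=> [i Pi|j]; last by have := Hm j; lra.
by have := He i; case: asboolP => // _; lra.
Qed.

End ProjectiveLine.

(** * Separating sources from sinks by a form *)

Section SourceSink.
Variables (R : realType) (D : nat) (d0 : 'I_D).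
Implicit Types (a b : 'I_D -> R * R).
Local Open Scope classical_set_scope.

(** Sending one source to infinity turns the projective line into an affine line, on which every
    other source lies below all sinks or above all sinks. Two cuts [al < - be] then isolate the
    sinks, and the form is minus the product of the linear forms vanishing at the cuts. *)
Lemma separating_form a b : (forall d, a d != 0) -> (forall d, b d != 0) ->
  (forall d d', exists C : set (R * R), [/\ C (line_pt (colv (b d))),
     C (line_pt (colv (b d'))), connected C, C `<=` @circle R
     & forall e, ~ C (line_pt (colv (a e)))]) ->
  exists Q : 'M[R]_2, forall d, qf Q (a d) < 0 < qf Q (b d).
Proof.
move=> a0 b0 HC.
have avoid (C : set (R * R)) e z : (forall e, ~ C (line_pt (colv (a e)))) ->
    z != 0 -> C (line_pt (colv z)) -> wedge (a e) z != 0.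
  move=> Ca z0 Cz; apply/eqP => /(wedge_eq0 (a0 e))[t zE]; apply: (Ca e).
  move: z0 Cz; rewrite {}zE => z0; rewrite line_pt_scl //.
  apply: contra_neq z0 => ->; by rewrite /scl !mul0r.
have w0 d e : wedge (a e) (b d) != 0.
  by have [C [Cb _ _ _ Ca]] := HC d d; exact: avoid Ca (b0 d) Cb.
(* The sign of this product tells on which side of the sources [e] and [e'] a sink lies. A connected
   set joins the two sinks without meeting a source, so the sign does not change. *)
have same e e' d d' : 0 < wedge (a e) (b d) * wedge (a e') (b d) ->
    0 < wedge (a e) (b d') * wedge (a e') (b d').
  have [C [Cb Cb' Cc CS Ca]] := HC d d'.
  rewrite -!qf_wedge_mx; apply: (qf_same_sign Cc) => // z z0 Cz.
  by rewrite qf_wedge_mx mulf_neq0 // (avoid C).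
pose o := a d0.
have no := nsq_gt0 (a0 d0); rewrite -/o in no.
(* [q] is normalized by [wedge o q = 1], so [tau] and [om] are the coordinates in the basis
   [(o, q)], and [t] is the affine coordinate with [o] at infinity. *)
pose q : R * R := (- o.2 / nsq o, o.1 / nsq o).
pose tau x := wedge x q; pose om x := wedge o x.
have wE x y : wedge x y = tau x * om y - om x * tau y.
  rewrite /tau /om /wedge /q /=; move: no; rewrite /nsq => no.
  by field; rewrite gt_eqF.
pose t x := tau x / om x.
have omb d : om (b d) != 0 by exact: w0.
have sideE d e : om (a e) != 0 -> wedge o (b d) * wedge (a e) (b d)
    = om (b d) ^+ 2 * om (a e) * (t (a e) - t (b d)).
  by move=> oa; rewrite (wE (a e)) -/(om (b d)) /t; field; rewrite oa omb.
have omb2 d : 0 < om (b d) ^+ 2 by rewrite exprn_even_gt0 //= omb.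
have neq d e : om (a e) != 0 -> t (a e) != t (b d).
  move=> oa; rewrite -subr_eq0; have := mulf_neq0 (w0 d d0) (w0 d e).
  by rewrite sideE // => /negP H; apply/negP => /eqP E; apply: H; rewrite E mulr0.
pose lo e := om (a e) != 0 /\ forall d, t (a e) < t (b d).
pose hi e := om (a e) != 0 /\ forall d, t (b d) < t (a e).
(* By [same], [t (a e) - t (b d)] has a sign independent of [d]. *)
have lohi e : om (a e) != 0 -> lo e \/ hi e.
  move=> oa.
  pose h d := om (a e) * (t (a e) - t (b d)).
  have hE d : wedge o (b d) * wedge (a e) (b d) = om (b d) ^+ 2 * h d.
    by rewrite sideE // /h mulrA.
  have hs d d' : 0 < h d -> 0 < h d'.
    by have := same d0 e d d'; rewrite -/o !hE !(pmulr_rgt0 _ (omb2 _)).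
  have h0 d : h d != 0 by rewrite mulf_neq0 // subr_eq0 neq.
  have [hp|hn] := ltP 0 (h d0).
    have {}hp d : 0 < h d by exact: hs hp.
    case: (ltgtP (om (a e)) 0) => s; last by rewrite s eqxx in oa.
      left; split=> // d; have := hp d; by rewrite nmulr_rgt0 // subr_lt0.
    right; split=> // d; have := hp d; by rewrite pmulr_rgt0 // subr_gt0.
  have {}hn d : h d < 0.
    by rewrite lt_neqAle h0 leNgt; apply/negP => /(hs _ d0); rewrite ltNge hn.
  case: (ltgtP (om (a e)) 0) => s; last by rewrite s eqxx in oa.
    right; split=> // d; have := hn d; by rewrite nmulr_rlt0 // subr_gt0.
  left; split=> // d; have := hn d; by rewrite pmulr_rlt0 // subr_lt0.
have [al [al1 al2]] : exists al, (forall e, lo e -> t (a e) < al) /\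
    forall d, al < t (b d).
  by apply: (finite_cut d0) => e d [_]; exact.
have [be [be1 be2]] : exists be, (forall e, hi e -> - t (a e) < be) /\
    forall d, be < - t (b d).
  by apply: (finite_cut d0) => e d [_ he]; rewrite ltrN2.
have abe : al < - be by have := al2 d0; have := be2 d0; lra.
pose u : R * R := q + scl al o; pose v : R * R := q + scl (- be) o.
exists (- wedge_mx u v) => d; rewrite !qfN !qf_wedge_mx.
have E x : wedge u x * wedge v x
    = (tau x - al * om x) * (tau x + be * om x).
  by rewrite /tau /om /u /v /wedge /scl /=; ring.
rewrite !E.
have tE x : om x != 0 -> (tau x - al * om x) * (tau x + be * om x)
    = om x ^+ 2 * ((t x - al) * (t x + be)).
  by move=> ox; rewrite /t; field.
apply/andP; split; last first.
  rewrite tE // oppr_gt0 pmulr_rlt0 //.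
  by have := al2 d; have := be2 d => ? ?; rewrite pmulr_rlt0; lra.
rewrite oppr_lt0.
(* Here the source is itself at infinity, and the product reduces to [tau (a d) ^+ 2], nonzero
   because [a d] is. *)
have [oa|oa] := eqVneq (om (a d)) 0.
  rewrite oa !mulr0 subr0 addr0 -expr2 exprn_even_gt0 //=.
  apply: contra_neq (a0 d) => ta.
  have /eqP := wE (a d) (- (a d).2, (a d).1); rewrite ta oa !mul0r subr0.
  have -> : wedge (a d) (- (a d).2, (a d).1) = nsq (a d).
    by rewrite /wedge /nsq /=; ring.
  by rewrite nsq_eq0 => /eqP.
rewrite tE // pmulr_rgt0 ?exprn_even_gt0 //.
case: (lohi d oa) => [/al1|/be1] Ht.
  by rewrite nmulr_rgt0; lra.
by rewrite pmulr_rgt0; lra.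
Qed.

Lemma source_sink_form (A : 'I_D -> 'M[R]_2) : (forall d, \det (A d) = 1) ->
  (forall d, hyperbolic (A d)) -> source_sink A ->
  exists (Q : 'M[R]_2) (eps : R) (e f : R * R),
    [/\ 0 < eps, forall d y, qf Q y + eps * nsq y <= qf Q (app (A d) y),
        e != 0 /\ 0 <= qf Q e & f != 0 /\ qf Q f <= 0].
Proof.
move=> A1 Ah As.
have /choice[w Hw] : forall d, exists w : (R * R) * (R * R) * (R * R),
    [/\ [/\ w.1.1 != 0, app (A d) w.1.1 = scl w.2.1 w.1.1 & `|w.2.1| < 1],
      [/\ w.1.2 != 0, app (A d) w.1.2 = scl w.2.2 w.1.2 & 1 < `|w.2.2|]
      & w.2.1 * w.2.2 = 1].
  move=> d; have [a [b [x1 [x2 H]]]] := hyperbolic_eigen (A1 d) (Ah d).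
  by exists (a, b, (x1, x2)).
have a0 d : (w d).1.1 != 0 by case: (Hw d) => -[].
have b0 d : (w d).1.2 != 0 by case: (Hw d) => _ [].
have src d : source_pt (A d) (line_pt (colv (w d).1.1)).
  by case: (Hw d) => -[? ? ?] _ _; apply: eigenline_colv; eauto.
have snk d : sink_pt (A d) (line_pt (colv (w d).1.2)).
  by case: (Hw d) => _ [? ? ?] _; apply: eigenline_colv; eauto.
have [|Q HQ] := @separating_form (fun d => (w d).1.1) (fun d => (w d).1.2) a0 b0.
  move=> d d'; have [C [Cb CS Cc] Cb'] := As _ _ _ _ (snk d) (snk d').
  exists C; split=> //; first by move=> z /CS[].
  by move=> e /CS[_]; apply; exists e.
have /choice[ep Hep] : forall d, exists ep, 0 < ep /\
    forall y, qf Q y + ep * nsq y <= qf Q (app (A d) y).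
  move=> d; have /andP[Qa Qb] := HQ d; have [[? ? ?] [? ? ?] ?] := Hw d.
  have [ep ? ?] : exists2 ep, 0 < ep &
      forall y, qf Q y + ep * nsq y <= qf Q (app (A d) y).
    by apply: (form_increases (a := (w d).1.1) (b := (w d).1.2)); eauto.
  by exists ep.
have [eps eps0 Heps] := fin_gap (fun d => (Hep d).1).
exists Q, eps, (w d0).1.2, (w d0).1.1; have /andP[Qa Qb] := HQ d0.
split=> //; [|by split=> //; exact: ltW|by split=> //; exact: ltW].
move=> d y; apply: le_trans ((Hep d).2 y).
by rewrite lerD2l ler_wpM2r ?nsq_ge0 // Heps.
Qed.

End SourceSink.

(** * Bounded orbits and the spectrum *)

Section NonHyperbolic.
Variable R : realType.
Implicit Types (M : 'M[R]_2) (x y : R * R).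

(** The inverse is the adjugate, whose entries obey the same bound. *)
Lemma app_bound_lower K M y : \det M = 1 -> mxbnd K M ->
  nsq y <= 4 * K ^+ 2 * nsq (app M y).
Proof.
rewrite det_mx2 => M1 /mxbndP[b1 b2 b3 b4].
have {1}-> : y = app (mx2 (M 1 1) (- M 0 1) (- M 1 0) (M 0 0)) (app M y).
  rewrite /app !mxE /= [LHS]surjective_pairing; congr pair;
    by rewrite -[LHS]mul1r -M1; ring.
by apply: app_bound; apply/mxbndP; rewrite !mxE /= !normrN; split.
Qed.

(* For [|tr M| < 2] the form [y |-> wedge y (app M y)] is definite and
   invariant under [M]; for [|tr M| = 2] an eigenvector has eigenvalue [1] or [-1]. *)
Lemma bounded_orbit M : \det M = 1 -> `|\tr M| <= 2 -> exists x c C,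
  0 < c /\ forall n, c <= nsq (iter n (app M) x) <= C.
Proof.
move=> M1; rewrite le_eqVlt => /orP[/eqP t2|t2].
  pose mu := \tr M / 2.
  have mu2 : mu ^+ 2 = 1.
    have : `|\tr M| ^+ 2 = 4 by rewrite t2; lra.
    by rewrite real_normK ?num_real // /mu; lra.
  have [|x x0 Mx] := @eigenvector_exists _ M mu M1.
    have -> : \tr M = 2 * mu by rewrite /mu; lra.
    lra.
  exists x, (nsq x), (nsq x); split; first exact: nsq_gt0.
  move=> n; suff [-> _] : nsq (iter n (app M) x) = nsq x /\
      app M (iter n (app M) x) = scl mu (iter n (app M) x) by rewrite lexx.
  elim: n => [|n [IH1 IH2]] //=; split; last by rewrite {1}IH2 appZ.
  by rewrite IH2 nsq_scl mu2 mul1r.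
have M1' := M1; rewrite det_mx2 in M1'.
pose q y := wedge y (app M y).
have qinv n : q (iter n (app M) (1, 0)) = M 1 0.
  elim: n => [|n IH] /=; first by rewrite /q /wedge /app /=; ring.
  by rewrite /q wedge_app M1 mul1r.
pose Dl := 4 - (\tr M) ^+ 2.
have Dl0 : 0 < Dl.
  by rewrite /Dl subr_gt0 -(real_normK (num_real (\tr M))); have := normr_ge0 (\tr M); nra.
have DlE : Dl = - 4 * (M 0 1 * M 1 0) - (M 1 1 - M 0 0) ^+ 2.
  by rewrite /Dl tr_mx2; lra.
(* Multiplying [q y] by [M 1 0] and by [- M 0 1] completes a square in each coordinate; adding the
   two gives definiteness. *)
have low y : Dl / 4 * nsq y <= (M 1 0 - M 0 1) * q y.
  have e1 : M 1 0 * q y = (M 1 0 * y.1 + (M 1 1 - M 0 0) / 2 * y.2) ^+ 2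
      + Dl / 4 * y.2 ^+ 2.
    by rewrite DlE /q /wedge /app /=; field.
  have e2 : - M 0 1 * q y = (- M 0 1 * y.2 + (M 1 1 - M 0 0) / 2 * y.1) ^+ 2
      + Dl / 4 * y.1 ^+ 2.
    by rewrite DlE /q /wedge /app /=; field.
  have := sqr_ge0 (M 1 0 * y.1 + (M 1 1 - M 0 0) / 2 * y.2).
  have := sqr_ge0 (- M 0 1 * y.2 + (M 1 1 - M 0 0) / 2 * y.1).
  rewrite /nsq; lra.
have [K K0 HK] := fin_bound (fun ij : 'I_2 * 'I_2 => `|M ij.1 ij.2|).
have up y : `|q y| <= 2 * (K + K) * nsq y.
  have -> : q y = qf (mx2 (M 1 0) (M 1 1) (- M 0 0) (- M 0 1)) y.
    by rewrite /q /wedge /app /qf !mxE /=; ring.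
  apply: qf_bound; apply/mxbndP; rewrite !mxE /= !normrN.
  have b i j : `|M i j| <= K + K by have := HK (i, j) => /= ?; lra.
  by split.
(* This entry is the invariant value of [q] along the orbit of [(1, 0)]; if it vanished, [Dl] would
   be nonpositive. *)
have c0 : M 1 0 != 0.
  apply/eqP => c0; have := Dl0; rewrite DlE c0.
  have := sqr_ge0 (M 1 1 - M 0 0); lra.
have K1 : 0 < 4 * K + 1 by lra.
exists (1, 0), (`|M 1 0| / (4 * K + 1)), ((M 1 0 - M 0 1) * M 1 0 / (Dl / 4)).
split; first by rewrite divr_gt0 // normr_gt0.
move=> n; have := low (iter n (app M) (1, 0)); have := up (iter n (app M) (1, 0)).
rewrite qinv; move: (iter n _ _) => y u l; apply/andP; split.
  by rewrite ler_pdivrMr //; have := nsq_ge0 y; lra.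
by rewrite ler_pdivlMr ?divr_gt0 // mulrC.
Qed.

End NonHyperbolic.

(** * Window sums of indicators *)

Section Indicators.
Variable R : realType.
Implicit Types (i p : int) (N m : nat).

Definition ind (b : bool) : R := b%:R.

Lemma wsum_point p N :
  wsum (fun i => ind (i == p)) N = ind (- N%:Z <= p < N%:Z).
Proof.
elim: N => [|N IH]; first by rewrite wsum0; have -> : (- 0%:Z <= p < 0) = false by lia.
rewrite wsumS IH /ind -!natrD; congr _%:R; lia.
Qed.

Lemma itv_recr p m i :
  ind (p <= i < p + m.+1%:Z) = ind (p <= i < p + m%:Z) + ind (i == p + m%:Z).
Proof. rewrite /ind -natrD; congr _%:R; lia. Qed.

Lemma wsum_itvS p m N : wsum (fun i => ind (p <= i < p + m.+1%:Z)) N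
  = wsum (fun i => ind (p <= i < p + m%:Z)) N + ind (- N%:Z <= p + m%:Z < N%:Z).
Proof.
by rewrite -wsum_point -wsumD; apply: eq_bigr => n _; rewrite !itv_recr.
Qed.

Lemma wsum_itv0 p N : wsum (fun i => ind (p <= i < p + 0%:Z)) N = 0.
Proof.
rewrite /wsum big1 // => n _.
have z i : (p <= i < p + 0%:Z) = false by lia.
by rewrite !z addr0.
Qed.

Lemma wsum_itv_le p m N : wsum (fun i => ind (p <= i < p + m%:Z)) N <= m%:R.
Proof.
elim: m => [|m IH]; first by rewrite wsum_itv0.
by rewrite wsum_itvS -natr1 lerD // lern1 leq_b1.
Qed.

Lemma wsum_itv p m N : (absz p + m <= N)%N ->
  wsum (fun i => ind (p <= i < p + m%:Z)) N = m%:R.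
Proof.
elim: m => [|m IH] pN; first by rewrite wsum_itv0.
rewrite wsum_itvS IH; last by lia.
by rewrite -natr1; congr (_ + _); rewrite /ind; have -> : (- N%:Z <= p + m%:Z < N%:Z) by lia.
Qed.

End Indicators.

(** * Cut-off solutions as approximate eigenvectors *)

Section Spectrum.
Variables (R : realType) (D : nat) (B : 'I_D -> seq (resonator R)).
Variables (chi : int -> 'I_D) (lam : R).
Hypothesis blocks : forall d, is_block (B d).
Local Notation kap := (kap B chi).
Local Notation P := (prop_at B chi lam).
Local Notation J := (jacobi B chi).

Let B_gt0 d : (0 < size (B d))%N. Proof. by case: (blocks d). Qed.
Let res_gt0 := res_seq_gt0 chi blocks.

Lemma homogeneous_solution (p : int) (v : R * R) : exists2 x : int -> R * R,
  x p = v & forall i, x (i + 1) = app (P i) (x i).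
Proof.
pose inv (M : 'M[R]_2) (y : R * R) : R * R :=
  (M 1 1 * y.1 - M 0 1 * y.2, M 0 0 * y.2 - M 1 0 * y.1).
pose fix fw n := if n is n'.+1 then app (P (p + n'%:Z)) (fw n') else v.
pose fix bw n := if n is n'.+1 then inv (P (p - n%:Z)) (bw n') else v.
exists (fun i => match i - p with Posz n => fw n | Negz n => bw n.+1 end).
  by rewrite subrr.
move=> i; case E : (i - p) => [n|[|n]].
- have -> : i + 1 - p = n.+1%:Z by lia.
  by rewrite /=; congr (app (P _) _); lia.
- have -> : i + 1 - p = 0 by lia.
  have -> : i = p - 1 by lia.
  by rewrite [RHS]app_inv // det_Pmat.
have -> : i + 1 - p = Negz n by lia.
have -> : i = p - n.+2%:Z by lia.
by rewrite [RHS]app_inv // det_Pmat.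
Qed.

Lemma iter_next_word (d : 'I_D) (j : int) m k r :
  (forall k, (k < m)%N -> chi (j + k%:Z) = d) -> (k < m)%N ->
  (r < size (B d))%N ->
  iter (r + k * size (B d)) (next_pos B chi) (j, 0%N) = (j + k%:Z, r).
Proof.
move=> Hc km rd.
have -> : iter (r + k * size (B d)) (next_pos B chi) (j, 0%N)
    = iter r (next_pos B chi) (j + k%:Z, 0%N).
  rewrite iterD; congr iter; elim: k km => [|k IH] km; first by rewrite addr0.
  rewrite mulSn iterD IH; last exact: ltnW.
  have -> : size (B d) = bsize B chi (j + k%:Z) by rewrite /bsize Hc // ltnW.
  by rewrite iter_next_block //; congr pair; lia.
by rewrite iter_next_in // /bsize Hc.
Qed.

Lemma orbit_in_word (d : 'I_D) (j : int) m p (x : int -> R * R) :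
  (forall k, (k < m)%N -> chi (j + k%:Z) = d) -> pos B chi p = (j, 0%N) ->
  (forall i, x (i + 1) = app (P i) (x i)) ->
  forall k r, (k < m)%N -> (r < size (B d))%N ->
  x (p + (r + k * size (B d))%N%:Z)
    = app (block_prop lam (take r (B d)))
          (iter k (app (block_prop lam (B d))) (x p)).
Proof.
move=> Hc Hp Hx k r km rd.
have step k' r' : (k' < m)%N -> (r' < size (B d))%N ->
    x (p + (r' + k' * size (B d))%N%:Z + 1)
      = app (Pmat lam (nth (dflt_res R) (B d) r'))
            (x (p + (r' + k' * size (B d))%N%:Z)).
  move=> km' rd'; rewrite Hx /prop_at res_seqE // pos_addn // Hp.
  by rewrite (iter_next_word Hc) // /res_at /= Hc.
have inner k' r' : (k' < m)%N -> (r' <= size (B d))%N ->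
    x (p + (r' + k' * size (B d))%N%:Z)
      = app (block_prop lam (take r' (B d))) (x (p + (k' * size (B d))%N%:Z)).
  move=> km'; elim: r' => [|r' IH] rd'.
    by rewrite add0n take0 /block_prop /= app1.
  rewrite (take_nth (dflt_res R)) // app_block_rcons -IH ?(ltnW rd') // -step //.
  by congr x; lia.
rewrite inner ?(ltnW rd) //; congr app.
elim: k km => [|k IH] km; first by rewrite mul0n addr0.
rewrite /= -IH ?(ltnW km) // mulSn inner ?(ltnW km) // take_size.
by [].
Qed.

(** At block starts [x] follows the bounded orbit of the block matrix. Inside a copy it differs by
    one of finitely many unimodular partial products, which cost a fixed factor; so [c] and [C]
    precede the length [n]. *)
Lemma orbit_bounds (d : 'I_D) : `|\tr (block_prop lam (B d))| <= 2 ->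
  pseudo_ergodic chi -> exists c C, 0 < c /\ forall n, exists p x,
    (forall i, x (i + 1) = app (P i) (x i)) /\
    forall t, (t <= n)%N -> c <= nsq (x (p + t%:Z)) <= C.
Proof.
move=> trd erg.
have A1 := det_block_prop lam (B d).
have [v [c [C [c0 Hv]]]] := bounded_orbit A1 trd.
have [K K0 HK] := fin_bound_nat (fun d => size (B d)) (fun d r =>
  \sum_(ij : 'I_2 * 'I_2) `|block_prop lam (take r (B d)) ij.1 ij.2|).
have bnd r : (r < size (B d))%N -> mxbnd (K + 1) (block_prop lam (take r (B d))).
  move=> rd a b; apply: (@le_trans _ _ K); last by lra.
  apply: le_trans (HK d r rd); rewrite (bigD1 (a, b)) //= lerDl.
  exact: sumr_ge0.
pose k := 4 * (K + 1) ^+ 2.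
have k0 : 0 < k by rewrite mulr_gt0 // exprn_gt0 //; lra.
exists (c / k), (k * C); split; first exact: divr_gt0.
(* Blocks are nonempty, so [n.+1] copies contain all offsets [t <= n]. *)
move=> n; have [j Hj] := erg (nseq n.+1 d).
have {}Hj l : (l < n.+1)%N -> chi (j + l%:Z) = d.
  by move=> ln; rewrite Hj ?size_nseq // nth_nseq ln.
have [p Hp] := pos_block_start chi B_gt0 j.
have [x xp Hx] := homogeneous_solution p v.
exists p, x; split=> // t tn.
have L0 := B_gt0 d.
rewrite (divn_eq t (size (B d))) addnC.
have rd : (t %% size (B d) < size (B d))%N by rewrite ltn_mod.
rewrite (orbit_in_word Hj Hp Hx) //; last first.
  by rewrite ltnS (leq_trans _ tn) // leq_div.
rewrite xp; have /andP[h1 h2] := Hv (t %/ size (B d))%N.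
apply/andP; split.
  rewrite ler_pdivrMr // mulrC; apply: le_trans h1 _.
  by apply: app_bound_lower; [exact: det_block_prop|exact: bnd].
apply: le_trans (app_bound _ (bnd _ rd)) _.
by rewrite -/k ler_pM2l.
Qed.

Lemma jac_aE i : jac_a B chi i = - (kap i * kap (i + 1) / ss B chi i).
Proof.
have [v0 l0 s0] := res_gt0 i; have [v1 l1 s1] := res_gt0 (i + 1).
rewrite /jac_a /kap sqrtrM ?ltW //.
by field; rewrite !gt_eqF // sqrtr_gt0.
Qed.

(** A resolvent constant [C0] would give a squared norm of [u] at most [C0 ^+ 2 * F] with [F] free
    of [n], whereas [low] makes it at least [c2 * n / 2]. *)
Theorem nonhyperbolic_in_spectrum (d : 'I_D) :
  `|\tr (block_prop lam (B d))| <= 2 -> pseudo_ergodic chi ->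
  in_spectrum J lam.
Proof.
move=> trd erg [_ [C0 HC0]].
have [c [C [c0 Horb]]] := orbit_bounds trd erg.
have [K [K0 Kb _]] := jacobi_bounds chi lam blocks.
pose K2 := K ^+ 2.
have K20 : 0 <= K2 by rewrite sqr_ge0.
have sqK (z : R) : 0 <= z -> z <= K -> z ^+ 2 <= K2.
  by move=> z0 zK; rewrite /K2 ler_sqr // nnegrE.
have kb i : kap i ^+ 2 <= K2.
  by have [? _ _ _] := Kb i; apply: sqK => //; apply: ltW; apply: kap_gt0.
have kVb i : (kap i)^-1 ^+ 2 <= K2.
  have [_ ? _ _] := Kb i; apply: sqK => //.
  by rewrite invr_ge0 ltW // kap_gt0.
have sVb i : (ss B chi i)^-1 ^+ 2 <= K2.
  have [_ _ _ ?] := Kb i; have [_ _ s0] := res_gt0 i; apply: sqK => //.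
  by rewrite invr_ge0 ltW.
have ab i : jac_a B chi i ^+ 2 <= K2 * K2 * K2.
  rewrite jac_aE sqrrN 2!exprMn; apply: ler_pM => //; rewrite ?sqr_ge0 //.
    by apply: mulr_ge0; exact: sqr_ge0.
  by apply: ler_pM => //; exact: sqr_ge0.
pose W := K2 * C.
pose F := 8 * (K2 * K2 * K2) * W.
(* The denominator bounds the squared state by two neighbouring values of [w]; the [+ 1] keeps it
   positive. *)
pose c2 := c / ((1 + 2 * K2) * K2 + 1).
have den : 0 < (1 + 2 * K2) * K2 + 1.
  by have := mulr_ge0 K20 K20; lra.
have c20 : 0 < c2 by rewrite divr_gt0.
have [n Hn] := exists_nat_gt (2 * (C0 ^+ 2 * F) / c2).
(* The cut-off keeps the sites [p + 1] to [p + n + 1]; one more site on each side enters [f]. *)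
have [p [x [Hx xb]]] := Horb n.+2.
pose w i := (x i).1 / kap i.
have wJ i : J w i = lam * w i.
  have := @state_unstep _ _ B chi lam res_gt0 x (fun=> 0) _ i.
  rewrite -/w => H; apply/eqP; rewrite -subr_eq0; apply/eqP; apply: H => l.
  by rewrite Hx /force /scl /= mul0r oppr0 !mul0r; case: (app _ _) => ? ? /=;
     congr pair; rewrite addr0.
have wb t : (t <= n.+2)%N -> w (p + t%:Z) ^+ 2 <= W.
  move=> tn; have /andP[_ xC] := xb t tn.
  rewrite /w /W exprMn mulrC ler_pM ?sqr_ge0 //.
  by apply: le_trans xC; rewrite lerDl sqr_ge0.
pose q := p + 1.
have qE (t : nat) : q + t%:Z = p + t.+1%:Z by rewrite /q; lia.
pose e i := ind R (q <= i < q + n.+1%:Z).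
pose u i := e i * w i.
pose f i := J u i - lam * u i.
(* [dl] marks the two bonds [(i, i + 1)] across which the cut-off [e] jumps. *)
pose dl i := ind R (i == p) + ind R (i == q + n%:Z).
have dlE i : (e (i + 1) - e i) ^+ 2 = dl i.
  rewrite /e /dl /ind /q.
  have [h1|h1] := eqVneq i p; have [h2|h2] := eqVneq i (p + 1 + n%:Z).
  - by lia.
  - have -> : (p + 1 <= i + 1 < p + 1 + n.+1%:Z) = true by lia.
    have -> : (p + 1 <= i < p + 1 + n.+1%:Z) = false by lia.
    by rewrite subr0 expr1n addr0.
  - have -> : (p + 1 <= i + 1 < p + 1 + n.+1%:Z) = false by lia.
    have -> : (p + 1 <= i < p + 1 + n.+1%:Z) = true by lia.
    by rewrite sub0r sqrrN expr1n add0r.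
  have -> : (p + 1 <= i + 1 < p + 1 + n.+1%:Z) = (p + 1 <= i < p + 1 + n.+1%:Z) by lia.
  by rewrite subrr expr0n addr0.
(* Since [w] solves the homogeneous equation, only the commutator of the operator with the cut-off
   remains. *)
have fE i : f i = jac_a B chi (i - 1) * ((e (i - 1) - e i) * w (i - 1))
    + jac_a B chi i * ((e (i + 1) - e i) * w (i + 1)).
  have := wJ i; rewrite /f /u /jacobi => h.
  have -> : lam * (e i * w i) = e i * (lam * w i) by ring.
  by rewrite -h; ring.
have W0 : 0 <= W by apply: le_trans (wb 0%N isT); exact: sqr_ge0.
have dl0 i : 0 <= dl i by rewrite addr_ge0 // ler0n.
have dw i : dl i * w i ^+ 2 <= dl i * W /\ dl i * w (i + 1) ^+ 2 <= dl i * W.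
  rewrite /dl /ind; have [->|h1] := eqVneq i p.
    rewrite !ler_wpM2l ?addr_ge0 ?ler0n //.
      by have := wb 1%N isT.
    by have := wb 0%N isT; rewrite addr0.
  have [->|h2] := eqVneq i (q + n%:Z); last by rewrite addr0 !mul0r.
  rewrite add0r !mul1r; split; first by rewrite qE; apply: wb.
  by have -> : q + n%:Z + 1 = p + n.+2%:Z by [rewrite /q; lia]; apply: wb.
have K6 : 0 <= K2 * K2 * K2 by rewrite !mulr_ge0.
have fb i : f i ^+ 2 <= 2 * (K2 * K2 * K2) * W * (dl (i - 1) + dl i).
  rewrite fE; set X := jac_a _ _ (i - 1) * _; set Y := jac_a _ _ i * _.
  have XY : (X + Y) ^+ 2 <= 2 * X ^+ 2 + 2 * Y ^+ 2.
    by have := sqr_ge0 (X - Y); lra.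
  have HX : X ^+ 2 <= K2 * K2 * K2 * (dl (i - 1) * W).
    rewrite exprMn ler_pM ?sqr_ge0 // exprMn -sqrrN opprB.
    by have := dlE (i - 1); rewrite subrK => ->; exact: (dw _).1.
  have HY : Y ^+ 2 <= K2 * K2 * K2 * (dl i * W).
    by rewrite exprMn ler_pM ?sqr_ge0 // exprMn dlE; exact: (dw _).2.
  lra.
have dls N : wsum dl N <= 2.
  have b1 (b : bool) : ind R b <= 1 by rewrite lern1 leq_b1.
  by rewrite wsumD !wsum_point; apply: le_trans (lerD (b1 _) (b1 _)) _; lra.
have fF N : wsum (fun i => f i ^+ 2) N <= F.
  apply: le_trans (ler_wsum (fun i _ => fb i)) _.
  rewrite wsumZ wsumD.
  have s1 := le_trans (wsum_shiftl N dl0) (dls N.+1).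
  have s2 := dls N.
  apply: (@le_trans _ _ (2 * (K2 * K2 * K2) * W * 4)); last by rewrite /F; lra.
  apply: ler_wpM2l; last by apply: le_trans (lerD s1 s2) _; lra.
  by apply: mulr_ge0 => //; apply: mulr_ge0.
have f2 : in_l2 f by exact: in_l2_wsum fF.
have u2 : in_l2 u.
  apply: (@in_l2_wsum _ _ (W * n.+1%:R)) => N.
  apply: (@le_trans _ _ (wsum (fun i => W * e i) N)); last first.
    by rewrite wsumZ ler_wpM2l // wsum_itv_le.
  apply: ler_wsum => i _; rewrite /u /e /ind.
  case: (boolP (q <= i < q + n.+1%:Z)) => hi; last by rewrite mul0r expr0n mulr0.
  rewrite mul1r mulr1; have -> : i = p + (absz (i - p))%:Z by move: hi; rewrite /q; lia.
  by apply: wb; move: hi; rewrite /q; lia.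
have uf : l2_norm u ^+ 2 <= C0 ^+ 2 * F.
  have H := HC0 u f u2 f2 (fun i => erefl).
  have fn : l2_norm f ^+ 2 <= F.
    rewrite -(sqr_sqrtr (_ : 0 <= F)); last first.
      by apply: le_trans (fF 0%N); rewrite wsum0.
    by rewrite ler_sqr ?nnegrE ?l2_norm_ge0 ?sqrtr_ge0 // l2_norm_le.
  apply: (@le_trans _ _ ((C0 * l2_norm f) ^+ 2)).
    by rewrite ler_sqr ?nnegrE ?l2_norm_ge0 // (le_trans _ H) // l2_norm_ge0.
  by rewrite exprMn ler_wpM2l ?sqr_ge0.
(* A single value of [w] may vanish, but two consecutive ones determine the state at [i + 1], which
   is bounded below. *)
have low i : c2 * ind R (q <= i < q + n%:Z) <= u i ^+ 2 + u (i + 1) ^+ 2.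
  rewrite {1}/ind; case: (boolP (q <= i < q + n%:Z)) => hi; last by rewrite mulr0 addr_ge0 ?sqr_ge0.
  have e1 : e i = 1 by rewrite /e; have -> : (q <= i < q + n.+1%:Z) by lia.
  have e2 : e (i + 1) = 1 by rewrite /e; have -> : (q <= i + 1 < q + n.+1%:Z) by lia.
  rewrite mulr1 /u e1 e2 !mul1r ler_pdivrMr //.
  have [t tn it] : exists2 t, (t <= n.+2)%N & i + 1 = p + t%:Z.
    by exists (absz (i + 1 - p)%R); move: hi; rewrite /q; lia.
  have /andP[xc _] := xb t tn; rewrite -it in xc.
  apply: le_trans xc _.
  have k0 j : kap j != 0 by rewrite gt_eqF // kap_gt0.
  have [_ _ s0] := res_gt0 i.
  have x2 : (x (i + 1)).2 = ((x (i + 1)).1 - (x i).1) / ss B chi i.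
    by rewrite Hx app_prop //=; field; rewrite gt_eqF // k0.
  have x1 j : (x j).1 ^+ 2 <= K2 * w j ^+ 2.
    have -> : (x j).1 = kap j * w j by rewrite /w mulrC divfK.
    by rewrite exprMn ler_wpM2r ?sqr_ge0.
  rewrite /nsq x2 [(_ / _) ^+ 2]exprMn.
  have d2 : ((x (i + 1)).1 - (x i).1) ^+ 2
      <= 2 * K2 * (w i ^+ 2 + w (i + 1) ^+ 2).
    have := sqr_ge0 ((x (i + 1)).1 + (x i).1).
    by have := x1 i; have := x1 (i + 1); lra.
  have := ler_pM (sqr_ge0 _) (sqr_ge0 _) d2 (sVb i).
  have := x1 (i + 1); have := mulr_ge0 K20 (sqr_ge0 (w i)).
  have := sqr_ge0 (w i); have := sqr_ge0 (w (i + 1)); lra.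
have := @wsum_itv R q n _ (leqnn _); set N := (_ + n)%N => nE.
have : c2 * n%:R <= 2 * l2_norm u ^+ 2.
  rewrite -nE -wsumZ; apply: le_trans (ler_wsum (fun i _ => low i)) _.
  rewrite wsumD.
  have := wsum_le_l2_norm u2 N.
  have := le_trans (wsum_shiftr N (sqr_int_ge0 u)) (wsum_le_l2_norm u2 N.+1).
  by move=> h1 h2; apply: le_trans (lerD h2 h1) _; lra.
move: Hn; rewrite ltr_pdivrMr //; lra.
Qed.

End Spectrum.

Theorem theorem3p20 (R : realType) (D : nat) (B : 'I_D -> seq (resonator R))
  (chi : int -> 'I_D) (lam : R) :
  (forall d, is_block (B d)) ->
  pseudo_ergodic chi ->
  0 <= lam ->
  ((forall d, hyperbolic (block_prop lam (B d))) ->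
    source_sink (fun d => block_prop lam (B d)) ->
    ~ in_spectrum (jacobi B chi) lam)
  /\
  ((exists d, `|\tr (block_prop lam (B d))| <= 2) ->
    in_spectrum (jacobi B chi) lam).
Proof.
move=> blocks erg _; split=> [hyp ss|[d trd]].
  (* [chi 0] witnesses that there is at least one block. *)
  have [Q [eps [e [f [eps0 HQ [e0 Qe] [f0 Qf]]]]]] :=
    source_sink_form (chi 0) (fun d => det_block_prop lam (B d)) hyp ss.
  apply; exact: form_in_resolvent eps0 HQ e0 Qe f0 Qf.
exact: nonhyperbolic_in_spectrum trd erg.
Qed.
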